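(* Let $k\ge 1$ and $\alpha_1,\beta_1,\beta_2\in\mathbb{R}$ with $\alpha_1^2+\beta_1\beta_2=\frac14$ and ($\beta_1\ne0$ or $\beta_2\neq 0$). Then the (local) projection $P_h^\star$ exists and is uniquely defined when $$\Gamma_j:=\beta_1-\frac{k^2}{h_j}+\beta_2\frac{k^2(k^2-1)}{h_j^2}\ne0\qquad\text{for all } j=1,\dots,N .$$ In addition, the following error estimates hold for $p=2,\infty$, for periodic $u\in W^{k+1,\infty}(I)$: $$\|P_h^\star u-u\|_{L^p(I)}\le C h^{k+1}|u|_{W^{k+1,\infty}(I)}\left(1+\frac{\max\left(|\beta_1|,\ \min\left(\frac{|\frac12-\alpha_1|}{h},\frac{|\frac12+\alpha_1|}{h}\right),\ \frac{|\beta_2|}{h^2}\right)}{\min_j|\Gamma_j|}\right).$$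
   Context: Mesh: $I=[a,b]$, $a=x_{1/2}<x_{3/2}<\dots<x_{N+1/2}=b$, $I_j=(x_{j-1/2},x_{j+1/2})$, $h_j=x_{j+1/2}-x_{j-1/2}$, $h=\max_jh_j$, with the mesh regularity requirement $h/\min_jh_j<\sigma$, $\sigma$ fixed during mesh refinement. $V_h^k$ is the space of functions on $I$ whose restriction to each $I_j$ is a polynomial of degree at most $k$. At an interface, $v^\pm$ denote the limits from the right ($+$) and left ($-$) cells, with periodic identification of $x_{1/2}$ and $x_{N+1/2}$; $[v]=v^+-v^-$, $\{v\}=\frac12(v^++v^-)$; the same notation is used for the piecewise derivative $v_x$. Projection $P_h^\star$ (depending on $\alpha_1,\beta_1,\beta_2$): for a periodic function $u$, $P_h^\star u$ is the unique $w\in V_h^k$ satisfying, for all $j=1,\dots,N$, (i) $\int_{I_j}w\,v_h\,dx=\int_{I_j}u\,v_h\,dx$ for all $v_h\in P^{k-2}(I_j)$ (void if $k=1$); (ii) $\{w\}-\alpha_1[w]+\beta_2[w_x]=u$ at $x_{j+1/2}$; (iii) $\{w_x\}+\alpha_1[w_x]+\beta_1[w]=u_x$ at $x_{j+1/2}$. ''Periodic $u\in W^{m,\infty}(I)$'' means that the $(b-a)$-periodic extension of $u$ has this regularity. $|u|_{W^{m,\infty}(I)}$ denotes the Sobolev seminorm. $C$ is a generic constant independent of the mesh size, of the parameters $\alpha_1,\beta_1,\beta_2$ (which may themselves depend on $h$), and of $u$. *)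

(* Defs.v *)
From HB Require Import structures.
From mathcomp Require Import all_boot all_order all_algebra.
From mathcomp Require Import all_classical all_reals all_analysis.
Set Implicit Arguments.
Unset Strict Implicit.
Unset Printing Implicit Defensive.
Import Order.TTheory GRing.Theory Num.Theory.
Import numFieldNormedType.Exports.
Local Open Scope classical_set_scope.
Local Open Scope ring_scope.

Definition test_function (R : realType) (D : set R) (phi : R -> R) : Prop :=
  (forall (i : nat) (y : R), derivable (derive1n i phi) y 1) /\
  exists K : set R, [/\ compact K, K `<=` D & forall y, ~ K y -> phi y = 0].

Definition weak_derivative (R : realType) (D : set R) (m : nat)
    (u g : R -> R) : Prop :=
  [/\ locally_integrable D u, locally_integrable D g &
   forall phi, test_function D phi ->
     \int[@lebesgue_measure R]_(y in D) (u y * derive1n m phi y) =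
     (-1) ^+ m * \int[@lebesgue_measure R]_(y in D) (g y * phi y)].

Definition Lp_norm (R : realType) (D : set R) (p : \bar R) (f : R -> R) : \bar R :=
  'N[@lebesgue_measure R]_p [EFin \o (f \_ D)].

Definition sobolev_infty (R : realType) (D : set R) (m : nat) (u : R -> R) : Prop :=
  forall i, (i <= m)%N ->
    exists g, weak_derivative D i u g /\ (Lp_norm D +oo%E g < +oo)%E.

(* The choice of the weak derivative is immaterial: it is unique a.e. on D. *)
Definition sobolev_infty_seminorm (R : realType) (D : set R) (m : nat)
    (u : R -> R) : \bar R :=
  Lp_norm D +oo%E (xget (cst 0 : R -> R) [set g | weak_derivative D m u g]).

(* [x i] stands for x_{i+1/2}, 0 <= i <= N, and cells are numbered from 0, so
   that [cell x j] stands for I_{j+1}; values [x i] with i > N are not used. *)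

Definition is_mesh (R : realType) (a b : R) (N : nat) (x : nat -> R) : Prop :=
  [/\ x 0%N = a, x N = b & forall j, (j < N)%N -> x j < x j.+1].

Definition cell (R : realType) (x : nat -> R) (j : nat) : set R :=
  `]x j, x j.+1[%classic.

Definition cell_size (R : realType) (x : nat -> R) (j : nat) : R := x j.+1 - x j.

(* For N > 0, which holds for any mesh of [a, b] with a < b, F 0 is one of the
   values F 0, ..., F (N-1), so the default of the bigop is harmless. *)
Definition min_cells (R : realType) (N : nat) (F : nat -> R) : R :=
  \big[Num.min/F 0%N]_(j < N) F j.

Definition mesh_size (R : realType) (N : nat) (x : nat -> R) : R :=
  \big[Num.max/0]_(j < N) cell_size x j.

Definition regular_mesh (R : realType) (sigma : R) (N : nat) (x : nat -> R) : Prop :=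
  mesh_size N x / min_cells N (cell_size x) < sigma.

(* The values of v at the interfaces and outside [x 0, x N] are irrelevant. *)
Definition Vh (R : realType) (k N : nat) (x : nat -> R) (v : R -> R) : Prop :=
  forall j, (j < N)%N -> exists q : {poly R},
    (size q <= k.+1)%N /\ forall y, cell x j y -> v y = q.[y].

(* Limits at the interface [x j.+1], j < N.  The cell to its right is the cell
   j.+1 modulo N: at the interface x N = b the limit v^+ is taken at x 0 = a. *)
Definition left_limit (R : realType) (x : nat -> R) (v : R -> R) (j : nat) : R :=
  lim (v y @[y --> (x j.+1)^'-]).

Definition right_limit (R : realType) (N : nat) (x : nat -> R) (v : R -> R)
    (j : nat) : R :=
  lim (v y @[y --> (x (j.+1 %% N)%N)^'+]).

Definition jump (R : realType) (N : nat) (x : nat -> R) (v : R -> R) (j : nat) : R :=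
  right_limit N x v j - left_limit x v j.

Definition average (R : realType) (N : nat) (x : nat -> R) (v : R -> R) (j : nat) : R :=
  2^-1 * (right_limit N x v j + left_limit x v j).

Definition is_Pstar (R : realType) (k N : nat) (x : nat -> R)
    (alpha1 beta1 beta2 : R) (u w : R -> R) : Prop :=
  Vh k N x w /\ forall j, (j < N)%N ->
  [/\ (* size v <= k - 1 means degree at most k - 2, and v = 0 when k = 1 *)
      forall v : {poly R}, (size v <= k.-1)%N ->
        \int[@lebesgue_measure R]_(y in cell x j) (w y * v.[y]) =
        \int[@lebesgue_measure R]_(y in cell x j) (u y * v.[y]),
      average N x w j - alpha1 * jump N x w j + beta2 * jump N x (derive1 w) j
        = u (x j.+1) &
      average N x (derive1 w) j + alpha1 * jump N x (derive1 w) j + beta1 * jump N x w j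
        = derive1 u (x j.+1)].

(* Well defined, up to interface values, when [is_Pstar] has a solution that is
   unique on the cells. *)
Definition Pstar (R : realType) (k N : nat) (x : nat -> R)
    (alpha1 beta1 beta2 : R) (u : R -> R) : R -> R :=
  xget (cst 0 : R -> R) [set w | is_Pstar k N x alpha1 beta1 beta2 u w].

Definition Gamma (R : realType) (k : nat) (x : nat -> R) (beta1 beta2 : R)
    (j : nat) : R :=
  beta1 - k%:R ^+ 2 / cell_size x j
  + beta2 * (k%:R ^+ 2 * (k%:R ^+ 2 - 1) / cell_size x j ^+ 2).

(* Data for which all terms defining P_h^* u make sense. *)
Definition Pstar_data (R : realType) (a b : R) (N : nat) (x : nat -> R)
    (u : R -> R) : Prop :=
  [/\ periodic u (b - a),
      (@lebesgue_measure R).-integrable `[a, b] (EFin \o u) &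
      forall j, (j < N)%N -> derivable u (x j.+1) 1].

(* Main.v *)
Require Import Defs.
From HB Require Import structures.
From mathcomp Require Import all_boot all_order all_algebra.
From mathcomp Require Import all_classical all_reals all_analysis.
From mathcomp Require Import measurable_realfun ess_sup_inf.
From mathcomp Require Import ring lra.
Set Implicit Arguments.
Unset Strict Implicit.
Unset Printing Implicit Defensive.
Import Order.TTheory GRing.Theory Num.Theory.
Import numFieldNormedType.Exports.
Local Open Scope classical_set_scope.
Local Open Scope ring_scope.

(* Since alpha1^2 + beta1 beta2 = 1/4, the matrices
   A+ = [[1/2 - alpha1, beta2], [beta1, 1/2 + alpha1]] and
   A- = [[1/2 + alpha1, -beta2], [-beta1, 1/2 - alpha1]] are complementary
   projections of rank one, and (ii)-(iii) say A+ (w+ - U) + A- (w- - U) = 0,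
   where U = (u, u_x) and w+, w- are the one-sided limits of (w, w_x).  So both
   terms vanish and the projection decouples into one problem per cell.  There,
   expanding in Legendre polynomials, the moments (i) fix all coefficients but
   the last two, which solve a 2x2 system of determinant proportional to Gamma_j.

   For the error, the cell problem is applied to u minus a local Taylor
   polynomial.  The Cramer formulas contain (|c| + |d|) / h_j, where
   c = 1/2 - alpha1 and d = 1/2 + alpha1; as c + d = 1, this is at most
   (1 + 2 min(|c|, |d|)) / h_j, and 1 / h_j is controlled by |Gamma_j|, |beta1|
   and |beta2| / h_j^2 through the very definition of Gamma_j.

   Taylor polynomials come from weak derivatives: if g is a weak derivative of
   order n + 1 of u on ]c, d[ then C + \int_c^x g is one of order n for some C
   (subtract from a test function a multiple of a fixed one of mass 1 and take
   the antiderivative).  Descending to order 0 recovers u itself. *)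

(** * Smooth functions and bump functions *)

(** The error bound must contain neither 1/beta1 nor 1/beta2, although which row of each rank-one
    pair of conditions can be kept depends on which of the two is nonzero. The 2x2 determinant is
    then 2 beta1 Gamma_j or 2 beta2 Gamma_j, and alpha1^2 + beta1 beta2 = 1/4 makes the numerators
    divisible by the same factor: a single formula with denominator 2 Gamma_j survives. As a
    polynomial T of degree at most k lies in the local space, w - T solves the cell problem with
    data u - T, of size h_j^(k+1) for values and h_j^k for derivatives. The same estimate with zero
    data yields uniqueness. The interface data are pointwise values of u and u_x, whereas the
    hypothesis speaks of weak derivatives. Regularity on the whole line makes u of class C^1 across
    every interface, a and b included, but the size of the remainders must come from the seminorm on
    ]a, b[ alone. Finally, the statement uses h where a cell only sees h_j; mesh regularity bridges
    them at the cost of a factor sigma^2. *)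

Definition smooth (R : realType) (f : R -> R) : Prop :=
  forall i y, derivable (derive1n i f) y 1.

(** Finite order makes induction possible for products: in (f g)' = f g' + g f' every factor loses
    at most one order. *)
Definition nsmooth (R : realType) (n : nat) (f : R -> R) : Prop :=
  forall i y, (i < n)%N -> derivable (derive1n i f) y 1.

Lemma nsmoothS (R : realType) (n : nat) (f : R -> R) :
  nsmooth n.+1 f <-> (forall y, derivable f y 1) /\ nsmooth n (derive1 f).
Proof.
split=> [sf|[df sf]].
- split=> [y|i y lt_in]; first exact: (sf 0%N).
  by have := sf i.+1 y; rewrite /derive1n iterSr; apply.
- by move=> [|i] y lt_in; [exact: df|rewrite /derive1n iterSr; apply: sf].
Qed.

Lemma nsmoothW (R : realType) (n : nat) (f : R -> R) :
  nsmooth n.+1 f -> nsmooth n f.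
Proof. by move=> sf i y lt_in; apply: sf; apply: ltnW. Qed.

Lemma nsmoothD (R : realType) (n : nat) (f g : R -> R) :
  nsmooth n f -> nsmooth n g -> nsmooth n (f \+ g).
Proof.
elim: n f g => [f g _ _ i y|n IH f g /nsmoothS[df sf] /nsmoothS[dg sg]].
  by rewrite ltn0.
apply/nsmoothS; split=> [y|]; first by apply: derivableD; [exact: df|exact: dg].
have -> : derive1 (f \+ g) = (derive1 f) \+ (derive1 g).
  apply/funext=> y; rewrite /= !derive1E.
  by apply: deriveD; [exact: df|exact: dg].
exact: IH.
Qed.

Lemma nsmoothM (R : realType) (n : nat) (f g : R -> R) :
  nsmooth n f -> nsmooth n g -> nsmooth n (f \* g).
Proof.
elim: n f g => [f g _ _ i y|n IH f g sf sg]; first by rewrite ltn0.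
have /nsmoothS[df sf'] := sf; have /nsmoothS[dg sg'] := sg.
apply/nsmoothS; split=> [y|]; first by apply: derivableM; [exact: df|exact: dg].
have -> : derive1 (f \* g) = (f \* (derive1 g)) \+ (g \* (derive1 f)).
  apply/funext=> y; rewrite /= !derive1E.
  by apply: deriveM; [exact: df|exact: dg].
apply: nsmoothD; apply: IH.
- exact: nsmoothW.
- exact: sg'.
- exact: nsmoothW.
- exact: sf'.
Qed.

Lemma smoothP (R : realType) (f : R -> R) :
  smooth f <-> forall n, nsmooth n f.
Proof.
by split=> [sf n i y _|sf i y]; [exact: sf|exact: (sf i.+1)].
Qed.

Lemma smoothD (R : realType) (f g : R -> R) :
  smooth f -> smooth g -> smooth (f \+ g).
Proof.
by move=> /smoothP sf /smoothP sg; apply/smoothP => n; exact: nsmoothD.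
Qed.

Lemma smoothM (R : realType) (f g : R -> R) :
  smooth f -> smooth g -> smooth (f \* g).
Proof.
by move=> /smoothP sf /smoothP sg; apply/smoothP => n; exact: nsmoothM.
Qed.

(** Avoids formulas for n-th derivatives: it is enough to exhibit a class of differentiable
    functions stable under differentiation. *)
Lemma smooth_coind (R : realType) (P : (R -> R) -> Prop) (f : R -> R) :
  (forall g, P g -> (forall y, derivable g y 1) /\ P (derive1 g)) -> P f -> smooth f.
Proof.
move=> PP Pf i; suff /PP[] : P (derive1n i f) by [].
by elim: i => [//|i IH]; rewrite derive1nS; exact: (PP _ IH).2.
Qed.

Lemma smooth_derive1 (R : realType) (f : R -> R) : smooth f -> smooth (derive1 f).
Proof. by move=> sf i y; have := sf i.+1 y; rewrite /derive1n iterSr. Qed.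

Lemma smooth_cst (R : realType) (c : R) : smooth (fun=> c).
Proof.
apply: (@smooth_coind _ (fun f => exists c, f = fun=> c)); last by exists c.
move=> _ [d ->]; split=> [y|]; first exact: derivable_cst.
by exists 0; apply/funext=> y; rewrite derive1_cst.
Qed.

Lemma derivable_smooth (R : realType) (f : R -> R) (y : R) :
  smooth f -> derivable f y 1.
Proof. by move=> sf; exact: (sf 0%N). Qed.

Lemma continuous_smooth (R : realType) (f : R -> R) : smooth f -> continuous f.
Proof.
move=> sf y; apply: differentiable_continuous.
by apply/derivable1_diffP; exact: derivable_smooth.
Qed.

Lemma smooth_antiderivative (R : realType) (f F : R -> R) :
  smooth f -> (forall y, is_derive y (1:R) F (f y)) -> smooth F.
Proof.
move=> sf dF.
have F'E : (derive1 F) = f by apply/funext=> y; rewrite derive1E derive_val.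
move=> [|i] y; first exact: ex_derive.
by rewrite /derive1n iterSr F'E; exact: sf.
Qed.

Lemma derive1nD (R : realType) (f g : R -> R) n : smooth f -> smooth g ->
  derive1n n (f \+ g) = derive1n n f \+ derive1n n g.
Proof.
move=> sf sg; elim: n => [|n IH]; first by rewrite !derive1n0.
rewrite !derive1nS IH; apply/funext=> y; rewrite /= !derive1E.
by apply: deriveD; [exact: sf|exact: sg].
Qed.

Lemma derive1nZ (R : realType) (f : R -> R) (c : R) n : smooth f ->
  derive1n n (fun y => c * f y) = fun y => c * derive1n n f y.
Proof.
move=> sf; elim: n => [|n IH]; first by rewrite !derive1n0.
rewrite !derive1nS IH; apply/funext=> y; rewrite /= !derive1E.
have -> : (fun y => c * (derive1n n f) y) = c \*: (derive1n n f) by apply/funext => z.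
by apply: deriveZ; exact: sf.
Qed.

Lemma smoothZ (R : realType) (f : R -> R) (c : R) :
  smooth f -> smooth (fun y => c * f y).
Proof.
move=> sf; have -> : (fun y => c * f y) = (fun=> c) \* f by apply/funext.
by apply: smoothM; [exact: smooth_cst|exact: sf].
Qed.

(* The functions p(1/x) exp(-1/x) form a class closed under differentiation. *)
Definition flat (R : realType) (p : {poly R}) (x : R) : R :=
  if 0 < x then p.[x^-1] * expR (- x^-1) else 0.

Lemma horner_bound (R : realType) (p : {poly R}) (B : R) : 0 <= B ->
  exists2 C, 0 <= C & forall y, `|y| <= B -> `|p.[y]| <= C.
Proof.
move=> B0; exists (\sum_(i < size p) `|p`_i| * B ^+ i).
  by apply: sumr_ge0 => i _; rewrite mulr_ge0// exprn_ge0.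
move=> y yB; rewrite horner_coef (le_trans (ler_norm_sum _ _ _))//.
apply: ler_sum => i _; rewrite normrM normrX ler_wpM2l//.
by apply: lerXn2r; rewrite ?nnegrE.
Qed.

Lemma horner_le_pow (R : realType) (p : {poly R}) :
  exists2 C, 0 <= C & forall s, 1 <= s -> `|p.[s]| <= C * s ^+ size p.
Proof.
exists (\sum_(i < size p) `|p`_i|); first by apply: sumr_ge0.
move=> s s1; rewrite horner_coef (le_trans (ler_norm_sum _ _ _))// mulr_suml.
apply: ler_sum => i _; rewrite normrM normrX ler_wpM2l//.
rewrite (ger0_norm (le_trans ler01 s1)).
by apply: ler_weXn2l => //; exact: ltnW.
Qed.

(** With s = 1/x, exp s dominates s^m / m! for m = [size p] + 2; the two powers of s in excess of
    the growth of p(s) leave x^2. This is what makes the derivative at 0 exist and vanish. *)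
Lemma flat_quadratic (R : realType) (p : {poly R}) :
  exists2 C, 0 <= C & forall x, 0 < x -> x <= 1 -> `|flat p x| <= C * x ^+ 2.
Proof.
have [C C0 HC] := horner_le_pow p.
pose n := (size p).+1.
exists (C * n.+1`!%:R); first by rewrite mulr_ge0.
move=> x x0 x1; rewrite /flat x0 normrM (ger0_norm (expR_ge0 _)).
have s1 : 1 <= x^-1 by rewrite invf_ge1.
have s0 : 0 < x^-1 by rewrite invr_gt0.
apply: (@le_trans _ _ (C * x^-1 ^+ size p * expR (- x^-1))).
  by rewrite ler_wpM2r ?expR_ge0// HC.
rewrite -!mulrA ler_wpM2l// expRN.
rewrite ler_pdivrMr ?expR_gt0// -mulrA.
have := expR_ge1Dxn n (ltW s0) => H.
have {}H : x^-1 ^+ n.+1 <= n.+1`!%:R * expR x^-1.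
  rewrite mulrC -ler_pdivrMr ?ltr0n ?fact_gt0//.
  by apply: le_trans H; rewrite lerDr.
apply: (@le_trans _ _ (x ^+ 2 * x^-1 ^+ n.+1)).
  rewrite /n !exprS expr0 mulr1 !mulrA; rewrite mulrK ?unitfE ?gt_eqF//.
  by rewrite divff ?gt_eqF// mul1r.
by rewrite [leRHS]mulrCA ler_wpM2l// sqr_ge0.
Qed.

Lemma is_derive_quadratic_bound (R : realType) (f : R -> R) (C : R) :
  f 0 = 0 -> 0 <= C ->
  (forall x, `|x| <= 1 -> `|f x| <= C * x ^+ 2) -> is_derive (0:R) (1:R) f 0.
Proof.
move=> f0 C0 fC.
have H : (h^-1 *: ((f \o shift 0) (h *: (1:R)) - f 0) @[h --> (0:R)^']) --> (0:R).
  apply/cvgrPdist_le => e e0.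
  have e'0 : 0 < Num.min 1 (e / (C + 1)).
    by rewrite lt_min ltr01 divr_gt0// ltr_wpDl.
  near=> h.
  have hn0 : h != 0 by near: h; exact: nbhs_dnbhs_neq.
  have : `|h| <= Num.min 1 (e / (C + 1)).
    by near: h; exact: dnbhs0_le.
  rewrite le_min => /andP[h1 he].
  rewrite sub0r normrN /= addr0 f0 subr0 normrZ /GRing.scale /= mulr1.
  rewrite normfV mulrC ler_pdivrMr ?normr_gt0//.
  apply: (le_trans (fC _ h1)).
  rewrite -[h ^+ 2]ger0_norm ?sqr_ge0// expr2 normrM mulrA.
  rewrite ler_wpM2r// (@le_trans _ _ ((C + 1) * `|h|))//.
    by rewrite ler_wpM2r// lerDl.
  by rewrite mulrC -ler_pdivlMr// ltr_wpDl.
apply: DeriveDef; first by apply/cvg_ex; exists 0.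
by apply/cvg_lim.
Unshelve. all: by end_near. Qed.

(** For s = 1/x one has ds/dx = - s^2, so that (p(s) exp(-s))' = s^2 (p(s) - p'(s)) exp(-s); the
    junction at 0 is covered by the quadratic bound. *)
Lemma is_derive_flat (R : realType) (p : {poly R}) (y : R) :
  is_derive y (1:R) (flat p) (flat ('X^2 * (p - p^`())) y).
Proof.
have [y0|y0|->] := ltgtP y 0.
- apply: (@near_eq_is_derive _ _ _ (fun=> 0)).
    near=> z; rewrite /flat ltNge.
    suff -> : z <= 0 by [].
    by near: z; exact: lt_le_nbhsl.
  by rewrite /flat ltNge ltW//=; exact: is_derive_cst.
- apply: (@near_eq_is_derive _ _ _ (fun z : R => p.[z^-1] * expR (- z^-1))).
    near=> z; rewrite /flat.
    suff -> : 0 < z by [].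
    by near: z; exact: lt_nbhsr.
  have yn0 : y != 0 by rewrite gt_eqF.
  have d1 : is_derive y (1:R) (fun z : R => z^-1) (- y ^- 2).
    have := @is_deriveV _ id y 1 1 yn0 (is_derive_id _ _).
    by rewrite /= /GRing.scale /= mulr1.
  have d2 := @is_derive1_comp _ (horner p) (fun z : R => z^-1) y _ _ (is_derive_poly _ _) d1.
  have d3 := @is_derive1_comp _ (@expR R) (fun z : R => - z^-1) y _ _
    (is_derive_expR _) (is_deriveN d1).
  have d4 := is_deriveM d2 d3.
  apply: (is_derive_eq d4).
  rewrite /flat y0 !hornerE /= /GRing.scale /=.
  by rewrite exprVn; ring.
- have [C C0 HC] := flat_quadratic p.
  rewrite [X in is_derive _ _ _ X]/flat ltxx.
  apply: (@is_derive_quadratic_bound _ _ C) => //.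
  + by rewrite /flat ltxx.
  + move=> x x1; have [x0|x0] := ltP 0 x.
      by apply: HC => //; rewrite -(ger0_norm (ltW x0)).
    by rewrite /flat ltNge x0 normr0 mulr_ge0// sqr_ge0.
Unshelve. all: by end_near. Qed.

Lemma smooth_flat (R : realType) (p : {poly R}) : smooth (flat p).
Proof.
apply: (@smooth_coind _ (fun f => exists q, f = flat q)); last by exists p.
move=> _ [q ->]; split=> [y|]; first by have [] := is_derive_flat q y.
exists ('X^2 * (q - q^`())); apply/funext=> y.
by rewrite derive1E; have [] := is_derive_flat q y.
Qed.

Lemma smooth_comp_affine (R : realType) (f : R -> R) (s t : R) :
  smooth f -> smooth (fun y => f (s * y + t)).
Proof.
move=> sf.
apply: (@smooth_coind _ (fun g => exists c n, g = fun y => c * derive1n n f (s * y + t)));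
  last by exists 1, 0%N; apply/funext=> y; rewrite mul1r.
move=> _ [c [n ->]].
have d1 y : is_derive y (1:R) (fun y : R => s * y + t) s.
  have H := is_deriveD (is_deriveZ s (is_derive_id y (1:R))) (is_derive_cst t y 1).
  by apply: (is_derive_eq H); rewrite /GRing.scale /= addr0 mulr1.
have d2 y : is_derive (s * y + t) (1:R) (derive1n n f) ((derive1n n.+1 f) (s * y + t)).
  by rewrite derive1nS derive1E; apply: derivableP; exact: sf.
have d3 y := @is_derive1_comp _ _ (fun y : R => s * y + t) y _ _ (d2 y) (d1 y).
have d4 y := is_deriveZ c (d3 y).
split=> [y|]; first by have [] := d4 y.
exists (c * s), n.+1; apply/funext=> y.
by rewrite derive1E; have [_ ->] := d4 y; rewrite /GRing.scale /=; ring.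
Qed.

Lemma smooth_bump (R : realType) (c d : R) : exists phi : R -> R,
  [/\ smooth phi, forall y, 0 <= phi y, forall y, c < y < d -> 0 < phi y
    & forall y, ~~ (c < y < d) -> phi y = 0].
Proof.
have fl1 x : 0 <= flat (1 : {poly R}) x.
  by rewrite /flat; case: ifP => // _; rewrite hornerE mul1r expR_ge0.
(* The product exp(-1/(y - c)) exp(-1/(d - y)) on ]c, d[, extended by 0. *)
exists ((fun y => flat 1 (1 * y + - c)) \* (fun y => flat 1 (- 1 * y + d))); split.
- by apply: smoothM; apply: smooth_comp_affine; exact: smooth_flat.
- by move=> y; rewrite mulr_ge0.
- move=> y /andP[cy yd]; rewrite /flat /= mul1r mulN1r subr_gt0 cy [- y + d]addrC subr_gt0 yd.
  have h1 (x : R) : (1 : {poly R}).[x] = 1 by rewrite hornerE.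
  by rewrite !h1 !mul1r; apply: mulr_gt0; exact: expR_gt0.
- move=> y; rewrite /flat /= mul1r mulN1r subr_gt0 [- y + d]addrC subr_gt0 negb_and.
  by case/orP => /negbTE ->; rewrite ?(mul0r, mulr0).
Qed.

(** * Integrals over a compact interval *)

Lemma integrable_cont (R : realType) (c d : R) (f : R -> R) :
  {within `[c, d], continuous f} ->
  (@lebesgue_measure R).-integrable `[c, d] (EFin \o f).
Proof.
move=> cf; apply: continuous_compact_integrable => //.
exact: segment_compact.
Qed.

Lemma integrable_contT (R : realType) (c d : R) (f : R -> R) :
  continuous f -> (@lebesgue_measure R).-integrable `[c, d] (EFin \o f).
Proof. by move=> cf; apply: integrable_cont; exact: continuous_subspaceT. Qed.

Lemma integrable_mul_cont (R : realType) (c d : R) (f g : R -> R) :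
  (@lebesgue_measure R).-integrable `[c, d] (EFin \o f) ->
  continuous g ->
  (@lebesgue_measure R).-integrable `[c, d] (EFin \o (fun x => f x * g x)).
Proof.
move=> fi cg.
have bg : bounded_set (g @` `[c, d]).
  apply: compact_bounded; apply: continuous_compact.
    exact: continuous_subspaceT.
  exact: segment_compact.
have mg : measurable_fun `[c, d] g.
  by apply: measurable_funTS; exact: continuous_measurable_fun.
have bg' : [bounded g x | x in (`[c, d] : set R)].
  case: bg => M [Mr HM]; exists M; split => // z Mz x cdx.
  by apply: HM Mz _ _; exists x.
by apply: (integrableMl _ fi mg bg'); exact: measurable_itv.
Qed.

Lemma integrable_cc_oo (R : realType) (c d : R) (f : R -> R) :
  (@lebesgue_measure R).-integrable `]c, d[ (EFin \o f) ->
  (@lebesgue_measure R).-integrable `[c, d] (EFin \o f).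
Proof.
move=> /integrableP[mf iy]; apply/integrableP; split.
  by apply/emeasurable_fun_itv_obnd_cbndP/emeasurable_fun_itv_bndo_bndcP.
rewrite (@integral_itv_bndoo _ _ _ _ true false)//.
exact: measurableT_comp.
Qed.

Lemma Rintegral_oo_cc (R : realType) (c d : R) (f : R -> R) :
  (@lebesgue_measure R).-integrable `]c, d[ (EFin \o f) ->
  \int[@lebesgue_measure R]_(x in `]c, d[) f x =
  \int[@lebesgue_measure R]_(x in `[c, d]) f x.
Proof.
move=> /integrableP[mf iy].
by rewrite /Rintegral (@integral_itv_bndoo _ _ _ _ true false).
Qed.

Lemma Rintegral_FTC (R : realType) (c d : R) (f F : R -> R) : c <= d ->
  {within `[c, d], continuous f} ->
  (forall y, is_derive y (1:R) F (f y)) ->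
  \int[@lebesgue_measure R]_(x in `[c, d]) f x = F d - F c.
Proof.
rewrite le_eqVlt => /predU1P[<- _ _|cd cf dF].
  by rewrite set_itv1 Rintegral_set1 subrr.
have cF y : {for y, continuous F}.
  apply: differentiable_continuous; apply/derivable1_diffP.
  by have [] := dF y.
rewrite /Rintegral (@continuous_FTC2 _ f F)//.
  split.
  - by move=> y _; have [] := dF y.
  - by apply: cvg_at_right_filter; exact: cF.
  - by apply: cvg_at_left_filter; exact: cF.
by move=> y _; rewrite derive1E; have [] := dF y.
Qed.

(** * Test functions on an open interval *)

Lemma is_derive_primitive (R : realType) (c d x : R) (f : R -> R) :
  (@lebesgue_measure R).-integrable `[c, d] (EFin \o f) ->
  c < x -> x < d -> {for x, continuous f} ->
  is_derive x (1:R) (fun y => \int[@lebesgue_measure R]_(t in `[c, y]) f t) (f x).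
Proof.
move=> fi cx xd cf.
have [df f'E] := @continuous_FTC1_closed R f c x d xd fi cx cf.
by apply: DeriveDef; [exact: df|rewrite -derive1E; exact: f'E].
Qed.

(** Compact support in ]c, d[ is recorded by an explicit interval [c', d'], which is easy to follow
    through sums, derivatives and primitives. *)
Definition test_on (R : realType) (c d : R) (phi : R -> R) : Prop :=
  smooth phi /\ exists c' d', [/\ c < c', c' <= d', d' < d &
    forall y, ~~ (c' <= y <= d') -> phi y = 0].

Lemma test_on_derive1n (R : realType) (c d : R) (phi : R -> R) (n : nat) :
  test_on c d phi -> test_on c d (derive1n n phi).
Proof.
move=> tphi; elim: n => [//|n [sphi [c' [d' [cc' cd' dd' Hphi]]]]].
rewrite derive1nS; split; first exact: smooth_derive1.
exists c', d'; split=> // y; rewrite negb_and -!ltNge => yo.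
rewrite -(derive1_cst (0:R) y) !derive1E; apply: near_eq_derive.
case/orP: yo => yo; near=> z; apply: Hphi; rewrite negb_and -!ltNge.
- by apply/orP; left; near: z; exact: lt_nbhsl.
- by apply/orP; right; near: z; exact: lt_nbhsr.
Unshelve. all: by end_near. Qed.

Lemma test_on_comb (R : realType) (c d : R) (phi psi : R -> R) (k : R) :
  test_on c d phi -> test_on c d psi ->
  test_on c d (phi \+ (fun y => k * psi y)).
Proof.
move=> [sphi [c1 [d1 [cc1 cd1 dd1 H1]]]] [spsi [c2 [d2 [cc2 cd2 dd2 H2]]]].
split; first by apply: smoothD; [exact: sphi|exact: smoothZ].
exists (Num.min c1 c2), (Num.max d1 d2); split.
- by rewrite lt_min cc1.
- by rewrite le_max ge_min cd1.
- by rewrite gt_max dd1.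
- move=> y; rewrite ge_min le_max !negb_and !negb_or => Hy /=.
  rewrite H1 ?H2 ?mulr0 ?addr0// negb_and;
  by case/orP: Hy => /andP[h1 h2]; rewrite ?h1 ?h2 ?orbT.
Qed.

Lemma Rintegral_eq0 (R : realType) (D : set R) (f : R -> R) :
  (forall x, D x -> f x = 0) -> \int[@lebesgue_measure R]_(x in D) f x = 0.
Proof.
move=> f0; rewrite /Rintegral integral0_eq// => x Dx.
by rewrite f0.
Qed.

(** Valid on the whole line: before the support both sides vanish, also for y < c, where [[c, y]] is
    empty. *)
Lemma is_derive_test_on_primitive (R : realType) (c d : R) (psi : R -> R) :
  test_on c d psi -> forall x, is_derive x (1:R)
    (fun y => \int[@lebesgue_measure R]_(t in `[c, y]) psi t) (psi x).
Proof.
move=> [spsi [c' [d' [cc' cd' dd' Hpsi]]]] x.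
have [xc'|c'x] := ltP x c'.
  rewrite Hpsi ?negb_and -?ltNge ?xc'//.
  apply: (@near_eq_is_derive _ _ _ (fun=> 0)).
  near=> z; rewrite Rintegral_eq0// => t /=; rewrite in_itv/= => /andP[ct tz].
  apply: Hpsi; rewrite negb_and -ltNge (le_lt_trans tz)//.
  by near: z; exact: lt_nbhsl.
apply: (@is_derive_primitive _ c (x + 1)).
- by apply: integrable_contT; exact: continuous_smooth.
- exact: lt_le_trans c'x.
- by rewrite ltrDl.
- exact: continuous_smooth.
Unshelve. all: by end_near. Qed.

Lemma test_on_antiderivative (R : realType) (c d : R) (psi : R -> R) :
  test_on c d psi -> \int[@lebesgue_measure R]_(x in `[c, d]) psi x = 0 ->
  exists2 Phi, test_on c d Phi & derive1 Phi = psi.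
Proof.
move=> [spsi [c' [d' [cc' cd' dd' Hpsi]]]] psi0.
pose Phi x := \int[@lebesgue_measure R]_(t in `[c, x]) psi t.
have cpsi := continuous_smooth spsi.
have dPhi : forall x, is_derive x (1:R) Phi (psi x).
  by apply: (is_derive_test_on_primitive (d := d)); split=> //; exists c', d'.
have Phi0 x : x < c' -> Phi x = 0.
  move=> xc'; apply: Rintegral_eq0 => z /=; rewrite in_itv/= => /andP[cz zx].
  by apply: Hpsi; rewrite negb_and -ltNge (le_lt_trans zx).
have incr x y : d' < x -> x <= y -> Phi x = Phi y.
  move=> d'x xy; apply/esym/eqP; rewrite -subr_eq0 -(Rintegral_FTC xy _ dPhi).
    apply/eqP; apply: Rintegral_eq0 => z /=; rewrite in_itv/= => /andP[xz zy].
    by apply: Hpsi; rewrite negb_and -!ltNge (lt_le_trans d'x)// orbT.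
  exact: continuous_subspaceT.
exists Phi; last first.
  by apply/funext => x; rewrite derive1E; have [] := dPhi x.
split; first exact: smooth_antiderivative dPhi.
(* Beyond d' the primitive is constant, and its value at d is the total integral of [psi], which is
   0: the zero mean is exactly what keeps the support compact. *)
exists c', d'; split=> // y; rewrite negb_and -!ltNge => /orP[/Phi0//|d'y].
have [yd|dy] := leP y d; first by rewrite (incr y d).
by rewrite -(incr d y)// ltW.
Qed.

Lemma is_derive_continuous (R : realType) (F : R -> R) (x l : R) :
  is_derive x (1:R) F l -> {for x, continuous F}.
Proof.
by move=> [dF _]; apply: differentiable_continuous; apply/derivable1_diffP.
Qed.

Lemma MVT_is_derive (R : realType) (F f : R -> R) (x y : R) : x < y ->
  (forall z, is_derive z (1:R) F (f z)) ->
  exists2 z, x < z < y & F y - F x = f z * (y - x).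
Proof.
move=> xy dF; have [|z zxy Fz] := MVT xy (fun z _ => dF z).
  by apply: continuous_subspaceT => z; exact: is_derive_continuous.
by exists z => //; move: zxy; rewrite in_itv.
Qed.

(** Strict positivity of the mass follows from the mean value theorem for the primitive on [c, p],
    [p, q] and [q, d]: the middle increment is positive, the outer two are nonnegative. *)
Lemma test_on_positive (R : realType) (c p q d : R) : c < p -> p < q -> q < d ->
  exists phi, [/\ test_on c d phi, forall y, 0 <= phi y,
    forall y, ~~ (p < y < q) -> phi y = 0 &
    0 < \int[@lebesgue_measure R]_(x in `[c, d]) phi x].
Proof.
move=> cp pq qd; have [phi [sphi phi0 phipos phiout]] := smooth_bump p q.
have tphi : test_on c d phi.
  split=> //; exists p, q; split=> // [|y yo]; first exact: ltW.
  by apply: phiout; apply: contra yo => /andP[py yq]; rewrite !ltW.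
exists phi; split=> //.
have dPhi := is_derive_test_on_primitive tphi.
rewrite (Rintegral_FTC _ _ dPhi); last 2 first.
- by rewrite ltW// (lt_trans cp)// (lt_trans pq).
- by apply: continuous_subspaceT; exact: continuous_smooth.
have [z1 _ E1] := MVT_is_derive cp dPhi.
have [z2 /phipos H2 E2] := MVT_is_derive pq dPhi.
have [z3 _ E3] := MVT_is_derive qd dPhi.
rewrite -(subrKA (\int[@lebesgue_measure R]_(t in `[c, q]) phi t)).
rewrite -[X in _ < _ + X](subrKA (\int[@lebesgue_measure R]_(t in `[c, p]) phi t)).
rewrite E1 E2 E3 addrA.
have h1 : 0 <= phi z1 * (p - c) by rewrite mulr_ge0// subr_ge0 ltW.
have h2 : 0 < phi z2 * (q - p) by rewrite mulr_gt0// subr_gt0.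
have h3 : 0 <= phi z3 * (d - q) by rewrite mulr_ge0// subr_ge0 ltW.
by rewrite ltr_wpDr// ltr_wpDl.
Qed.

Lemma test_on_mass1 (R : realType) (c d : R) : c < d -> exists2 theta,
  test_on c d theta & \int[@lebesgue_measure R]_(x in `[c, d]) theta x = 1.
Proof.
move=> cd; have [||| phi [[sphi [c' [d' [cc' cd' dd' Hphi]]]] _ _ I0]] :=
  @test_on_positive R c (c + (d - c) / 3) (c + (d - c) / 3 * 2) d; try lra.
set I := \int[_]_(x in _) _ in I0.
exists (fun x => I^-1 * phi x).
  split; first exact: smoothZ.
  by exists c', d'; split=> // y /Hphi ->; rewrite mulr0.
rewrite RintegralZl//.
  by rewrite mulVf// gt_eqF.
by apply: integrable_contT; exact: continuous_smooth.
Qed.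

Lemma integrable_patchT (R : realType) (i : interval R) (f : R -> R) :
  (@lebesgue_measure R).-integrable [set` i] (EFin \o f) ->
  (@lebesgue_measure R).-integrable [set: R] (EFin \o (f \_ [set` i])).
Proof.
move=> fi; rewrite -restrict_EFin.
by apply/integrable_restrict => //; rewrite setTI.
Qed.

Lemma integrable_sub_itv (R : realType) (i j : interval R) (f : R -> R) :
  (@lebesgue_measure R).-integrable [set` i] (EFin \o f) ->
  [set` j] `<=` [set` i] ->
  (@lebesgue_measure R).-integrable [set` j] (EFin \o f).
Proof. by move=> fi ji; apply: integrableS fi. Qed.

Lemma integralZl_patch (R : realType) (i : interval R) (f : R -> R) (r : R) :
  (@lebesgue_measure R).-integrable [set` i] (EFin \o f) ->
  (\int[@lebesgue_measure R]_x (r%:E * ((f \_ [set` i]) x)%:E) =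
   (r * \int[@lebesgue_measure R]_(x in [set` i]) f x)%R%:E)%E.
Proof.
move=> fi; rewrite integralZl//; last exact: integrable_patchT.
rewrite EFinM; congr (_ * _)%E; rewrite /Rintegral fineK.
  by rewrite [RHS]integral_mkcond restrict_EFin.
exact: integrable_fin_num.
Qed.

(** Fubini's theorem for g(t) psi(x) on the triangle t <= x. *)
Lemma integral_primitive_mul (R : realType) (c d : R) (g psi : R -> R) :
  (@lebesgue_measure R).-integrable `[c, d] (EFin \o g) ->
  (@lebesgue_measure R).-integrable `[c, d] (EFin \o psi) ->
  \int[@lebesgue_measure R]_(x in `[c, d])
     ((\int[@lebesgue_measure R]_(t in `[c, x]) g t) * psi x) =
  \int[@lebesgue_measure R]_(t in `[c, d])
     (g t * \int[@lebesgue_measure R]_(x in `[t, d]) psi x).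
Proof.
move=> gi psii; pose D : set R := `[c, d]%classic.
pose mu := @lebesgue_measure R.
pose f (z : measurableTypeR R * measurableTypeR R) : \bar R :=
  ((g \_ D) z.1 * (psi \_ D) z.2 * ((z.1 : R) <= z.2)%R%:R)%:E.
have mD : measurable (D : set (measurableTypeR R)) by exact: measurable_itv.
have giT : mu.-integrable setT (EFin \o (g \_ D)).
  exact: integrable_patchT.
have piT : mu.-integrable setT (EFin \o (psi \_ D)).
  exact: integrable_patchT.
have mg : measurable_fun [set: measurableTypeR R] (g \_ D).
  by apply/measurable_EFinP; case/integrableP: giT.
have mp : measurable_fun [set: measurableTypeR R] (psi \_ D).
  by apply/measurable_EFinP; case/integrableP: piT.
have mf : measurable_fun [set: measurableTypeR R * measurableTypeR R] f.
  apply/measurable_EFinP; apply: measurable_funM.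
    by apply: measurable_funM; apply: measurableT_comp.
  have -> : (fun z : measurableTypeR R * measurableTypeR R => ((z.1 : R) <= z.2)%R%:R : R) =
    (fun z => if ((z.1 : R) <= z.2)%R then 1%R else 0%R).
    by apply/funext => z; case: (_ <= _).
  apply: measurable_fun_ifT => //.
  exact: measurable_realfun.measurable_fun_ler.
(* Without the indicator of the triangle the integrand is a product, integrable by Tonelli's
   theorem; it dominates [f]. *)
have f0i : (mu \x mu)%E.-integrable setT
    (fun z => ((g \_ D) z.1 * (psi \_ D) z.2)%:E).
  apply/integrable12ltyP.
    by apply/measurable_EFinP/measurable_funM; exact: measurableT_comp.
  have inner x : (\int[mu]_y `|((g \_ D) x * (psi \_ D) y)%:E| =
      `|(g \_ D) x|%:E * \int[mu]_y `|((psi \_ D) y)%:E|)%E.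
    rewrite -(@integralZl _ _ _ mu)//; last exact: integrable_abse.
    by apply: eq_integral => y _; rewrite abse_EFin normrM EFinM.
  under eq_integral => x _ do rewrite inner.
  have [_ py] := integrableP _ _ _ piT.
  have pfin : (\int[mu]_y `|((psi \_ D) y)%:E|)%E \is a fin_num.
    by rewrite ge0_fin_numE// integral_ge0.
  rewrite -(fineK pfin) (@integralZr _ _ _ mu)//; last exact: (integrable_abse giT).
  have [_ gy] := integrableP _ _ _ giT.
  have gfin : (\int[mu]_y `|((g \_ D) y)%:E|)%E \is a fin_num.
    by rewrite ge0_fin_numE// integral_ge0.
  by rewrite -(fineK gfin) -EFinM ltry.
have fi : (mu \x mu)%E.-integrable setT f.
  apply: le_integrable f0i => // z _; rewrite /f lee_fin normrM.
  by rewrite ler_piMr// normr_nat lern1 leq_b1.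
have /(congr1 fine) Efub := Fubini fi.
transitivity (fine (\int[mu]_y \int[mu]_x f (x, y))%E); last first.
  rewrite -Efub [RHS]Rintegral_mkcond; congr fine; apply: eq_integral => t _.
  rewrite patchE; case: ifPn => [/[!inE] tD|tD]; last first.
    by apply: integral0_eq => x _; rewrite /f/= patchE (negbTE tD) !mul0r.
  rewrite (@eq_integral _ _ _ mu _ (fun x => (g t)%:E * ((psi \_ `[t, d]) x)%:E)%E); last first.
    move=> x _; rewrite /f -EFinM/= patchE mem_set// -mulrA; congr (_ * _)%:E.
    rewrite !patchE !mem_setE; move: tD; rewrite /D/= !in_itv/= => /andP[ct td].
    have [tx|xt] := leP t x; last by rewrite mulr0.
    by rewrite (le_trans ct tx)/= mulr1.
  have ti : mu.-integrable `[t, d] (EFin \o psi).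
    apply: (integrable_sub_itv psii).
    by apply: subset_itvr; move: tD; rewrite /D/= in_itv/= bnd_simp => /andP[].
  exact: integralZl_patch.
rewrite Rintegral_mkcond; congr fine; apply: eq_integral => x _; apply/esym.
rewrite patchE; case: ifPn => [/[!inE] xD|xD]; last first.
  by apply: integral0_eq => t _; rewrite /f/= [(psi \_ _) x]patchE (negbTE xD) mulr0 mul0r.
rewrite (@eq_integral _ _ _ mu _ (fun t => (psi x)%:E * ((g \_ `[c, x]) t)%:E)%E); last first.
  move=> t _; rewrite /f -EFinM/= [(psi \_ _) x]patchE mem_set// mulrAC mulrC; congr (_ * _)%:E.
  rewrite !patchE !mem_setE; move: xD; rewrite /D/= !in_itv/= => /andP[cx xd].
  have [tx|xt] := leP t x; last by rewrite mulr0 andbF.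
  by rewrite (le_trans tx xd)/= mulr1 !andbT.
have xi : mu.-integrable `[c, x] (EFin \o g).
  apply: (integrable_sub_itv gi).
  by apply: subset_itvl; move: xD; rewrite /D/= in_itv/= bnd_simp => /andP[].
rewrite mulrC; exact: integralZl_patch.
Qed.

(** * Weak derivatives *)

(** Only the duality identity of [weak_derivative], over the closed interval on which primitives and
    continuity are stated; integrability is carried separately. *)
Definition weak_on (R : realType) (c d : R) (n : nat) (u g : R -> R) : Prop :=
  forall phi, test_on c d phi ->
    \int[@lebesgue_measure R]_(x in `[c, d]) (u x * derive1n n phi x) =
    (-1) ^+ n * \int[@lebesgue_measure R]_(x in `[c, d]) (g x * phi x).

Lemma within_continuous_primitive (R : realType) (c d C : R) (g : R -> R) :
  c <= d -> (@lebesgue_measure R).-integrable `[c, d] (EFin \o g) ->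
  {within `[c, d], continuous
    (fun x => C + \int[@lebesgue_measure R]_(t in `[c, x]) g t)}.
Proof.
move=> cd gi; have cG := parameterized_integral_continuous cd gi.
move=> x; apply: cvgD; first exact: cvg_cst.
exact: cG.
Qed.

Lemma test_on_endpoint (R : realType) (c d : R) (phi : R -> R) :
  test_on c d phi -> phi d = 0.
Proof.
move=> [_ [c' [d' [_ _ dd' Hphi]]]]; apply: Hphi.
by rewrite negb_and -!ltNge dd' orbT.
Qed.

(** As g is merely integrable, its primitive need not be differentiable everywhere; exchanging the
    integrals replaces classical integration by parts, the inner integral of Phi' over [t, d] being
    - Phi(t). *)
Lemma primitive_by_parts (R : realType) (c d : R) (g Phi : R -> R) :
  (@lebesgue_measure R).-integrable `[c, d] (EFin \o g) ->
  test_on c d Phi ->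
  \int[@lebesgue_measure R]_(x in `[c, d])
     ((\int[@lebesgue_measure R]_(t in `[c, x]) g t) * derive1 Phi x) =
  - \int[@lebesgue_measure R]_(x in `[c, d]) (g x * Phi x).
Proof.
move=> gi tPhi; have [sPhi _] := tPhi.
have sPhi' := smooth_derive1 sPhi.
have cPhi' := continuous_smooth sPhi'.
rewrite integral_primitive_mul//; last exact: integrable_contT.
rewrite -mulN1r -RintegralZl//; last first.
  by apply: integrable_mul_cont => //; exact: continuous_smooth.
apply: eq_Rintegral => t; rewrite inE /= in_itv/= => /andP[ct td].
have -> : \int[@lebesgue_measure R]_(x in `[t, d]) derive1 Phi x = Phi d - Phi t.
  apply: Rintegral_FTC => //; first exact: continuous_subspaceT.
  by move=> y; rewrite derive1E; apply: derivableP; exact: derivable_smooth.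
by rewrite (test_on_endpoint tPhi) sub0r mulN1r mulrN.
Qed.

Lemma weak_on_lower (R : realType) (c d : R) (n : nat) (u g : R -> R) : c < d ->
  (@lebesgue_measure R).-integrable `[c, d] (EFin \o u) ->
  (@lebesgue_measure R).-integrable `[c, d] (EFin \o g) ->
  weak_on c d n.+1 u g ->
  exists C, weak_on c d n u
    (fun x => C + \int[@lebesgue_measure R]_(t in `[c, x]) g t).
Proof.
move=> cd ui gi ug.
have [theta ttheta theta1] := test_on_mass1 cd.
set G := fun x => \int[@lebesgue_measure R]_(t in `[c, x]) g t.
have Gi : (@lebesgue_measure R).-integrable `[c, d] (EFin \o G).
  apply: integrable_cont; apply: parameterized_integral_continuous => //.
  exact: ltW.
have tc (phi : R -> R) m : test_on c d phi -> continuous (derive1n m phi).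
  by move=> tphi; apply: continuous_smooth; exact: (test_on_derive1n m tphi).1.
have Bi (f phi : R -> R) m : (@lebesgue_measure R).-integrable `[c, d] (EFin \o f) ->
    test_on c d phi -> (@lebesgue_measure R).-integrable `[c, d]
      (EFin \o (fun x => f x * derive1n m phi x)).
  by move=> fi tphi; apply: integrable_mul_cont => //; exact: tc.
pose A := \int[@lebesgue_measure R]_(x in `[c, d]) (u x * derive1n n theta x).
pose L := \int[@lebesgue_measure R]_(x in `[c, d]) (G x * theta x).
(* The constant is forced by testing against [theta]: since its mass is 1, the identity reads (-1)^n
   A = C + L. *)
exists ((-1) ^+ n * A - L) => phi tphi.
pose I := \int[@lebesgue_measure R]_(x in `[c, d]) phi x.
have tpsi := test_on_comb (- I) tphi ttheta.
have iphi : (@lebesgue_measure R).-integrable `[c, d] (EFin \o phi).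
  by apply: integrable_contT; exact: (tc _ 0%N tphi).
have itheta : (@lebesgue_measure R).-integrable `[c, d] (EFin \o theta).
  by apply: integrable_contT; exact: (tc _ 0%N ttheta).
have sptheta : smooth (fun y => - I * theta y) by apply: smoothZ; exact: ttheta.1.
have split_int f m : (@lebesgue_measure R).-integrable `[c, d] (EFin \o f) ->
  \int[@lebesgue_measure R]_(x in `[c, d])
     (f x * derive1n m (phi \+ (fun y => - I * theta y)) x) =
  \int[@lebesgue_measure R]_(x in `[c, d]) (f x * derive1n m phi x) -
  I * \int[@lebesgue_measure R]_(x in `[c, d]) (f x * derive1n m theta x).
  move=> fi; rewrite -RintegralZl//; last exact: Bi.
  rewrite -RintegralB//; last 2 first.
  - exact: Bi.
  - have -> : (EFin \o (fun x => I * (f x * derive1n m theta x))) =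
      (EFin \o (fun x => (I * f x) * derive1n m theta x)).
      by apply/funext => x /=; rewrite mulrA.
    apply: Bi => //.
    have -> : (EFin \o (fun x => I * f x)) = (fun x => I%:E * (EFin \o f) x)%E.
      by apply/funext => x.
    exact: integrableZl.
  apply: eq_Rintegral => x _.
  rewrite (derive1nD _ tphi.1 sptheta) (derive1nZ _ _ ttheta.1) /=.
  by ring.
have [|Phi tPhi dPhi] := test_on_antiderivative tpsi.
  rewrite RintegralD//; last first.
    exact: integrable_contT (continuous_smooth sptheta).
  by rewrite RintegralZl// theta1 mulr1 -/I subrr.
have E1 := ug _ tPhi.
have E2 := primitive_by_parts gi tPhi.
have E3 := split_int u n ui.
have E4 := split_int G 0%N Gi.
rewrite /derive1n iterSr -/(derive1n n _) dPhi in E1.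
rewrite dPhi in E2.
rewrite !derive1n0 in E4.
rewrite E3 -/A in E1.
rewrite E4 -/L in E2.
have -> : \int[@lebesgue_measure R]_(x in `[c, d])
    (((-1) ^+ n * A - L + G x) * phi x) =
  ((-1) ^+ n * A - L) * I + \int[@lebesgue_measure R]_(x in `[c, d]) (G x * phi x).
  have Ki : (@lebesgue_measure R).-integrable `[c, d]
      (EFin \o (fun x => ((-1) ^+ n * A - L) * phi x)).
    apply: (integrable_mul_cont (f := fun=> (-1) ^+ n * A - L)); last exact: (tc _ 0%N).
    by apply: integrable_contT; exact: cst_continuous.
  under eq_Rintegral => x _ do rewrite mulrDl.
  by rewrite RintegralD// ?RintegralZl//; exact: (Bi _ _ 0%N).
have S2 : (-1) ^+ n * (-1) ^+ n = 1 :> R by rewrite -expr2 sqrr_sign.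
move: E1 E2; set X := \int[_]_(x in _) _; set Y := \int[_]_(x in _) _.
set Z := \int[_]_(x in _) _ => E1 E2.
have -> : X = (-1) ^+ n.+1 * Y + I * A by rewrite -E1; ring.
have -> : Z = - Y + I * L by rewrite -E2; ring.
have -> : (-1) ^+ n * (((-1) ^+ n * A - L) * I + (- Y + I * L)) =
  ((-1) ^+ n * (-1) ^+ n) * A * I - (-1) ^+ n * Y by ring.
by rewrite S2 exprS; ring.
Qed.

(* The filter instance of [ae] is not found for [lebesgue_measure]: its measurable
   structure is only convertible to the canonical one. *)
Lemma ae_lebesgue_impl (R : realType) (P Q : R -> Prop) :
  (forall x, P x -> Q x) ->
  {ae @lebesgue_measure R, forall x, P x} -> {ae @lebesgue_measure R, forall x, Q x}.
Proof.
by move=> PQ; apply: filterS PQ; exact: (ae_filter_ringOfSetsType (@lebesgue_measure R)).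
Qed.

Lemma integrable_fun_sub (R : realType) (D : set R) (f g : R -> R) : measurable D ->
  (@lebesgue_measure R).-integrable D (EFin \o f) ->
  (@lebesgue_measure R).-integrable D (EFin \o g) ->
  (@lebesgue_measure R).-integrable D (EFin \o (fun x => f x - g x)).
Proof. by move=> mD fi gi; apply: (integrableB _ fi gi). Qed.

(** Half of the fundamental lemma of the calculus of variations: if u exceeded F at x0, then u - F >
    e > 0 near x0, and a nonnegative bump supported there would have a nonpositive integral. The
    other half follows by exchanging u and F. *)
Lemma weak_on0_le (R : realType) (c d x0 : R) (u F : R -> R) :
  {within `[c, d], continuous u} -> {within `[c, d], continuous F} ->
  weak_on c d 0 u F -> c < x0 < d -> u x0 <= F x0.
Proof.
move=> cu cF uF x0cd; rewrite leNgt; apply/negP => Fu.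
have /andP[cx0 x0d] := x0cd; have cd := lt_trans cx0 x0d.
pose h x := u x - F x; pose e := h x0 / 2.
have hx0 : 0 < h x0 by rewrite subr_gt0.
have e0 : 0 < e by rewrite divr_gt0.
have ch : {for x0, continuous h}.
  have /(continuous_within_itvP _ cd)[cu' _ _] := cu.
  have /(continuous_within_itvP _ cd)[cF' _ _] := cF.
  by apply: continuousB; [apply: cu'|apply: cF']; rewrite in_itv/=.
have : \forall x \near x0, [/\ c < x, x < d & e < h x].
  near=> x; split.
  - by near: x; exact: lt_nbhsr.
  - by near: x; exact: lt_nbhsl.
  - near: x; apply: (cvgr_gt _ ch); rewrite /e.
    by rewrite ltr_pdivrMr// mulr_natr mulr2n ltrDl.
move=> /nbhs_ballP[r /= r0 Hr].
have xin x : x0 - r < x < x0 + r -> [/\ c < x, x < d & e < h x].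
  by move=> xr; apply: Hr; rewrite /ball/= distrC ltr_distl.
have [|cp _ _] := xin (x0 - r / 2); first by lra.
have [|_ qd _] := xin (x0 + r / 2); first by lra.
have pq : x0 - r / 2 < x0 + r / 2 by lra.
have [phi [tphi phi0 phiout I0]] := test_on_positive cp pq qd.
have cphi := continuous_smooth tphi.1.
have ui := integrable_mul_cont (integrable_cont cu) cphi.
have Fi := integrable_mul_cont (integrable_cont cF) cphi.
have := uF _ tphi; rewrite derive1n0 expr0 mul1r => /eqP.
rewrite -subr_eq0 -RintegralB// => /eqP E0.
have : e * \int[@lebesgue_measure R]_(x in `[c, d]) phi x <= 0.
  rewrite -E0 -RintegralZl//; last exact: integrable_contT.
  apply: le_Rintegral => //.
  - have := integrable_mul_cont (integrable_contT c d (@cst_continuous _ _ e)) cphi.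
    by [].
  - exact: integrable_fun_sub.
  - move=> x xcd; rewrite -mulrBl.
    have [/andP[px xq]|xo] := boolP (x0 - r / 2 < x < x0 + r / 2).
      rewrite ler_wpM2r// ltW//.
      by have [] := xin x; first by lra.
    by rewrite phiout// !mulr0.
by rewrite leNgt mulr_gt0.
Unshelve. all: by end_near. Qed.

Lemma weak_on0_eq (R : realType) (c d : R) (u F : R -> R) :
  {within `[c, d], continuous u} -> {within `[c, d], continuous F} ->
  weak_on c d 0 u F -> forall x, c < x < d -> u x = F x.
Proof.
move=> cu cF uF x xcd; apply/le_anti/andP; split.
  exact: (weak_on0_le cu cF).
apply: (weak_on0_le cF cu) xcd => phi tphi.
by rewrite expr0 mul1r derive1n0; have := uF _ tphi; rewrite expr0 mul1r derive1n0.
Qed.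

(** * Taylor polynomials obtained by descending through weak derivatives *)

Lemma poly_antiderivative (R : realType) (p : {poly R}) :
  exists2 P : {poly R}, (size P <= (size p).+1)%N & P^`() = p.
Proof.
(* At i = 0 the coefficient is a quotient by 0, hence 0, and differentiation discards it anyway. *)
exists (\poly_(i < (size p).+1) (p`_i.-1 / i%:R)); first exact: size_poly.
apply/polyP => i; rewrite coef_deriv coef_poly ltnS /=.
case: ltnP => [_|ip]; last by rewrite mul0rn nth_default.
by rewrite -[LHS]mulr_natr divfK// pnatr_eq0.
Qed.

Lemma Rintegral_horner (R : realType) (c d : R) (p P : {poly R}) : c <= d ->
  P^`() = p ->
  \int[@lebesgue_measure R]_(x in `[c, d]) p.[x] = P.[d] - P.[c].
Proof.
move=> cd dP; apply: Rintegral_FTC => //.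
  by apply: continuous_subspaceT; exact: continuous_horner.
by move=> y; rewrite -dP; exact: is_derive_poly.
Qed.

Lemma le_norm_Rintegral_ae (R : realType) (c d K : R) (f : R -> R) : c <= d ->
  (@lebesgue_measure R).-integrable `[c, d] (EFin \o f) -> 0 <= K ->
  {ae @lebesgue_measure R, forall x, `[c, d]%classic x -> `|f x| <= K} ->
  `|\int[@lebesgue_measure R]_(x in `[c, d]) f x| <= K * (d - c).
Proof.
move=> cd fi K0 fK; rewrite -lee_fin EFin_normr_Rintegral//.
have mf := measurable_int _ fi.
apply: (le_trans (le_abse_integral _ _ _)) => //.
apply: (@le_trans _ _ (\int[@lebesgue_measure R]_(x in `[c, d]) K%:E)%E).
  apply: ae_ge0_le_integral => //.
  by apply: measurableT_comp.
by rewrite integral_cst//= lebesgue_measure_itv/= lte_fin; case: ltP => // dc;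
  rewrite mule0 lee_fin mulr_ge0// subr_ge0.
Qed.

(** The constant added to P makes the polynomial equal to C at c, so the difference is exactly the
    integral of g - T from c to x. *)
Lemma primitive_poly_bound (R : realType) (c d K C : R) (g : R -> R) (T P : {poly R}) :
  c <= d -> (@lebesgue_measure R).-integrable `[c, d] (EFin \o g) ->
  {ae @lebesgue_measure R, forall x, `[c, d]%classic x -> `|g x - T.[x]| <= K} ->
  0 <= K -> P^`() = T ->
  forall x, c <= x <= d ->
  `|C + \int[@lebesgue_measure R]_(t in `[c, x]) g t
    - (P + (C - P.[c])%:P).[x]| <= K * (d - c).
Proof.
move=> cd gi gT K0 dP x /andP[cx xd].
have sub : (`[c, x]%classic : set R) `<=` `[c, d]%classic.
  by apply: subset_itvl; rewrite bnd_simp.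
have gxi := integrable_sub_itv gi sub.
have Ti : (@lebesgue_measure R).-integrable `[c, x] (EFin \o (fun t => T.[t])).
  by apply: integrable_contT; exact: continuous_horner.
have -> : C + \int[@lebesgue_measure R]_(t in `[c, x]) g t
    - (P + (C - P.[c])%:P).[x] =
  \int[@lebesgue_measure R]_(t in `[c, x]) (g t - T.[t]).
  by rewrite RintegralB// (Rintegral_horner cx dP) hornerD hornerC; ring.
apply: (@le_trans _ _ (K * (x - c))); last by rewrite ler_wpM2l// lerB.
apply: le_norm_Rintegral_ae => //.
  exact: integrable_fun_sub.
by apply: ae_lebesgue_impl gT => t Ht xt; apply: Ht; exact: sub.
Qed.

(** One descent: the order of the weak derivative drops by one, the degree of the polynomial rises
    by at most one, and the remainder gains a factor d - c. The last clause turns weak into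
    classical derivatives once g is continuous. *)
Lemma weak_on_lower_poly (R : realType) (c d : R) (n : nat) (u g : R -> R)
    (T : {poly R}) (K : R) : c < d -> 0 <= K ->
  {within `[c, d], continuous u} ->
  (@lebesgue_measure R).-integrable `[c, d] (EFin \o g) ->
  {ae @lebesgue_measure R, forall x, `[c, d]%classic x -> `|g x - T.[x]| <= K} ->
  weak_on c d n.+1 u g ->
  exists (G : R -> R) (P : {poly R}), [/\ weak_on c d n u G,
    {within `[c, d], continuous G}, (size P <= (size T).+1)%N /\ P^`() = T,
    forall x, c <= x <= d -> `|G x - P.[x]| <= K * (d - c) &
    forall x, c < x < d -> {for x, continuous g} -> is_derive x (1:R) G (g x)].
Proof.
move=> cd K0 cu gi gT ug.
have [C uG] := weak_on_lower cd (integrable_cont cu) gi ug.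
have [P sP dP] := poly_antiderivative T.
exists (fun x => C + \int[@lebesgue_measure R]_(t in `[c, x]) g t).
exists (P + (C - P.[c])%:P); split=> //.
- by apply: within_continuous_primitive => //; exact: ltW.
- split; last by rewrite derivD derivC addr0.
  apply: leq_trans (size_polyD _ _) _; rewrite geq_max sP /=.
  exact: leq_trans (size_polyC_leq1 _) _.
- exact: primitive_poly_bound (ltW cd) gi gT K0 dP.
- move=> x /andP[cx xd] cgx.
  have := is_deriveD (is_derive_cst C x 1) (is_derive_primitive gi cx xd cgx).
  by rewrite add0r.
Qed.

(** The descent ends at order 0, where the function found equals u inside the interval. The function
    met one step earlier is then the classical derivative of u, whence one power of d - c fewer in
    its bound. *)
Lemma weak_taylor_cont (R : realType) (c d : R) (n : nat) (u g : R -> R)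
    (T : {poly R}) (K : R) : c < d -> 0 <= K ->
  {within `[c, d], continuous u} -> {within `[c, d], continuous g} ->
  (forall x, c <= x <= d -> `|g x - T.[x]| <= K) ->
  weak_on c d n.+1 u g ->
  exists (F : R -> R) (P : {poly R}), (size P <= n.+1 + size T)%N /\
    forall x, c < x < d -> [/\ is_derive x (1:R) u (F x), {for x, continuous F},
      `|u x - P.[x]| <= K * (d - c) ^+ n.+1 &
      `|F x - P^`().[x]| <= K * (d - c) ^+ n].
Proof.
move=> cd + cu; elim: n g T K => [|n IH] g T K K0 cg gT ug.
all: have gT' : {ae @lebesgue_measure R,
    forall x, `[c, d]%classic x -> `|g x - T.[x]| <= K}.
1,3: by apply: aeW => x xcd; apply: gT; move: xcd; rewrite /= in_itv.
all: have [G [P [uG cG [sP dP] bnd dG]]] :=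
  weak_on_lower_poly cd K0 cu (integrable_cont cg) gT' ug.
- have uE := weak_on0_eq cu cG uG.
  exists g, P; split=> // x xcd; have /andP[cx xd] := xcd.
  have cgx : {for x, continuous g}.
    by have /(continuous_within_itvP _ cd)[cg' _ _] := cg; apply: cg'; rewrite in_itv.
  split.
  + apply: (@near_eq_is_derive _ _ _ G); last exact: dG.
    near=> y; rewrite uE//; apply/andP; split.
      by near: y; exact: lt_nbhsr.
    by near: y; exact: lt_nbhsl.
  + exact: cgx.
  + by rewrite uE// expr1; apply: bnd; rewrite !ltW.
  + by rewrite dP expr0 mulr1; apply: gT; rewrite !ltW.
- have K'0 : 0 <= K * (d - c) by rewrite mulr_ge0// subr_ge0 ltW.
  have [F [Q [sQ HF]]] := IH _ _ _ K'0 cG bnd uG.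
  exists F, Q; split.
    by rewrite (leq_trans sQ)// [leqRHS]addSnnS leq_add2l.
  by move=> x /HF[dF cF H1 H2]; split=> //; rewrite exprS mulrA.
Unshelve. all: by end_near. Qed.

Lemma weak_taylor (R : realType) (c d : R) (k : nat) (u g : R -> R) (M : R) :
  c < d -> 0 <= M -> (0 < k)%N -> {within `[c, d], continuous u} ->
  (@lebesgue_measure R).-integrable `[c, d] (EFin \o g) ->
  {ae @lebesgue_measure R, forall x, `[c, d]%classic x -> `|g x| <= M} ->
  weak_on c d k.+1 u g ->
  exists (F : R -> R) (P : {poly R}), (size P <= k.+1)%N /\
    forall x, c < x < d -> [/\ is_derive x (1:R) u (F x), {for x, continuous F},
      `|u x - P.[x]| <= M * (d - c) ^+ k.+1 &
      `|F x - P^`().[x]| <= M * (d - c) ^+ k].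
Proof.
case: k => // n cd M0 _ cu gi gM ug.
have gT : {ae @lebesgue_measure R, forall x, `[c, d]%classic x ->
    `|g x - (0 : {poly R}).[x]| <= M}.
  by apply: ae_lebesgue_impl gM => x Hx xcd; rewrite horner0 subr0; exact: Hx.
(* The first descent is separate: g is only bounded almost everywhere and is compared with the zero
   polynomial, while everything obtained afterwards is continuous. As k > 0, at least one further
   descent follows, which makes u of class C^1. *)
have [G [T [uG cG [sT _] bnd _]]] := weak_on_lower_poly cd M0 cu gi gT ug.
have M'0 : 0 <= M * (d - c) by rewrite mulr_ge0// subr_ge0 ltW.
have [F [P [sP HF]]] := weak_taylor_cont cd M'0 cu cG bnd uG.
exists F, P; split.
  by rewrite (leq_trans sP)// -[n.+2]addn1 leq_add2l (leq_trans sT)// size_poly0.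
by move=> x /HF[H1 H2 H3 H4]; split=> //; rewrite exprS mulrA.
Qed.

(** * Localization of Sobolev functions to an interval *)

Lemma test_function_of_test_on (R : realType) (c d : R) (D : set R) (phi : R -> R) :
  `]c, d[%classic `<=` D -> test_on c d phi -> test_function D phi.
Proof.
move=> cdD [sphi [c' [d' [cc' cd' dd' Hphi]]]]; split=> //.
exists `[c', d']%classic; split.
- exact: segment_compact.
- apply: subset_trans cdD => x /=; rewrite !in_itv/= => /andP[cx xd].
  by rewrite (lt_le_trans cc')// (le_lt_trans xd).
- by move=> y /negP; rewrite /= in_itv/=; exact: Hphi.
Qed.

Lemma test_on_of_test_function (R : realType) (c d : R) (phi : R -> R) : c < d ->
  test_function `]c, d[ phi -> test_on c d phi.
Proof.
move=> cd [sphi [K [cK Kcd Kphi]]]; split=> //.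
have [K0|/negPn/eqP K0] := boolP (K != set0); last first.
  (* An empty support means phi = 0, and any point of ]c, d[ serves as support interval. *)
  exists ((c + d) / 2), ((c + d) / 2); split; [lra|exact: lexx|lra|].
  by move=> y _; apply: Kphi; rewrite K0.
have cid : {within K, continuous (@idfun R)} by apply: continuous_subspaceT => x; exact: cvg_id.
move/set0P in K0.
have [c' c'K Hc] := compact_EVT_min K0 cK cid.
have [d' d'K Hd] := compact_EVT_max K0 cK cid.
rewrite !inE in c'K d'K.
have := Kcd _ c'K; rewrite /= in_itv/= => /andP[cc' _].
have := Kcd _ d'K; rewrite /= in_itv/= => /andP[_ dd'].
exists c', d'; split=> //; first by apply: Hd; rewrite inE.
move=> y yo; apply: Kphi => yK; move/negP: yo; apply.
by rewrite Hc ?Hd// inE.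
Qed.

Lemma Rintegral_support (R : realType) (c d : R) (D : set R) (f : R -> R) :
  `]c, d[%classic `<=` D -> (forall x, ~~ (c < x < d) -> f x = 0) ->
  \int[@lebesgue_measure R]_(x in D) f x =
  \int[@lebesgue_measure R]_(x in `[c, d]) f x.
Proof.
move=> cdD f0; rewrite Rintegral_mkcond [RHS]Rintegral_mkcond.
suff -> : f \_ D = f \_ `[c, d] by []; apply/funext => x; rewrite !patchE.
have [xcd|/f0 ->] := boolP (c < x < d); last by rewrite !if_same.
rewrite !mem_set//=.
  by rewrite in_itv/=; move/andP: xcd => [? ?]; rewrite !ltW.
by apply: cdD; rewrite /= in_itv.
Qed.

Lemma test_on_out (R : realType) (c d : R) (phi : R -> R) (x : R) :
  test_on c d phi -> ~~ (c < x < d) -> phi x = 0.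
Proof.
move=> [_ [c' [d' [cc' _ dd' Hphi]]]] xo; apply: Hphi; apply: contra xo.
by move=> /andP[cx xd]; rewrite (lt_le_trans cc')// (le_lt_trans xd).
Qed.

Lemma weak_on_weak_derivative (R : realType) (c d : R) (D : set R) (m : nat)
    (u g : R -> R) : `]c, d[%classic `<=` D ->
  weak_derivative D m u g -> weak_on c d m u g.
Proof.
move=> cdD [_ _ ug] phi tphi.
have := ug _ (test_function_of_test_on cdD tphi).
rewrite !(Rintegral_support cdD)// => x xo.
- by rewrite (test_on_out tphi xo) mulr0.
- by rewrite (test_on_out (test_on_derive1n m tphi) xo) mulr0.
Qed.

Lemma locally_integrableS (R : realType) (D E : set R) (f : R -> R) :
  open E -> E `<=` D -> locally_integrable D f -> locally_integrable E f.
Proof.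
move=> oE ED [mf oD fK]; split=> //.
  by apply: measurable_funS mf => //; exact: open_measurable.
by move=> K KE; apply: fK; exact: subset_trans ED.
Qed.

(** Guarantees that the choice made by [xget] in the seminorm on ]a, b[ is made in a nonempty set,
    so that it really is a weak derivative. *)
Lemma weak_derivative_setT (R : realType) (c d : R) (m : nat) (u g : R -> R) :
  c < d -> weak_derivative [set: R] m u g -> weak_derivative `]c, d[ m u g.
Proof.
move=> cd ug; have [lu lg _] := ug; split.
- by apply: locally_integrableS lu => //; exact: interval_open.
- by apply: locally_integrableS lg => //; exact: interval_open.
move=> phi /(test_on_of_test_function cd) tphi.
have := weak_on_weak_derivative (@subsetT _ _) ug tphi.
rewrite -!(@Rintegral_support _ _ _ `]c, d[%classic)// => x xo.
- by rewrite (test_on_out tphi xo) mulr0.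
- by rewrite (test_on_out (test_on_derive1n m tphi) xo) mulr0.
Qed.

Lemma integrable_ae_bounded (R : realType) (c d M : R) (g : R -> R) :
  measurable_fun `]c, d[ g -> 0 <= M ->
  {ae @lebesgue_measure R, forall x, `]c, d[%classic x -> `|g x| <= M} ->
  (@lebesgue_measure R).-integrable `[c, d] (EFin \o g).
Proof.
move=> mg M0 gM; apply: integrable_cc_oo; apply/integrableP; split.
  exact/measurable_EFinP.
apply: (@le_lt_trans _ _ (\int[@lebesgue_measure R]_(x in `]c, d[) M%:E)%E).
  apply: ae_ge0_le_integral => //.
  by apply: measurableT_comp => //; exact/measurable_EFinP.
rewrite integral_cst//= lebesgue_measure_itv/= lte_fin.
by case: (ltP c d) => _; [rewrite -EFinB -EFinM ltry|rewrite mule0 lt0y].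
Qed.

Lemma lebesgue_measure_setT_gt0 (R : realType) :
  (0 < @lebesgue_measure R [set: R])%E.
Proof. by rewrite -set_itvNyy lebesgue_measure_itv /= ltry. Qed.

Lemma ae_Lp_norm_infty (R : realType) (D : set R) (M : R) (g : R -> R) :
  (Lp_norm D +oo%E g <= M%:E)%E ->
  {ae @lebesgue_measure R, forall x, D x -> `|g x| <= M}.
Proof.
rewrite /Lp_norm unlock /Lnorm lebesgue_measure_setT_gt0 => /ess_supP.
by apply: ae_lebesgue_impl => x /=; rewrite lee_fin patchE => Hx Dx; move: Hx; rewrite mem_set.
Qed.

(** The interface data are values at end points of cells, which the interior estimates reach only by
    continuity. *)
Lemma le_closed_itv (R : realType) (c d K : R) (f : R -> R) : c < d ->
  continuous f -> (forall x, c < x < d -> f x <= K) ->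
  forall x, c <= x <= d -> f x <= K.
Proof.
move=> cd cf fK x /andP[]; rewrite le_eqVlt => /predU1P[<- _|cx].
  rewrite leNgt; apply/negP => Kf.
  near c^'+ => y; have : K < f y.
    near: y; apply: (cvgr_gt (f c)) => //; apply: cvg_at_right_filter; exact: cf.
  by rewrite ltNge fK//; apply/andP; split; near: y;
    [exact: nbhs_right_gt|exact: nbhs_right_lt].
rewrite le_eqVlt => /predU1P[->|xd]; last by rewrite fK// cx.
rewrite leNgt; apply/negP => Kf.
near d^'- => y; have : K < f y.
  near: y; apply: (cvgr_gt (f d)) => //; apply: cvg_at_left_filter; exact: cf.
by rewrite ltNge fK//; apply/andP; split; near: y;
  [exact: nbhs_left_gt|exact: nbhs_left_lt].
Unshelve. all: by end_near. Qed.

Lemma weak_derivative_taylor (R : realType) (D : set R) (c d M : R) (k : nat)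
    (u g : R -> R) : c < d -> 0 <= M -> (0 < k)%N -> `]c, d[%classic `<=` D ->
  continuous u -> weak_derivative D k.+1 u g -> (Lp_norm D +oo%E g <= M%:E)%E ->
  exists (F : R -> R) (P : {poly R}), (size P <= k.+1)%N /\
    forall x, c < x < d -> [/\ is_derive x (1:R) u (F x), {for x, continuous F},
      `|u x - P.[x]| <= M * (d - c) ^+ k.+1 &
      `|F x - P^`().[x]| <= M * (d - c) ^+ k].
Proof.
move=> cd M0 k0 cdD cu ug /ae_Lp_norm_infty gM.
have [_ [mg oD _] _] := ug.
have gM' : {ae @lebesgue_measure R, forall x, `]c, d[%classic x -> `|g x| <= M}.
  by apply: ae_lebesgue_impl gM => x Hx xcd; apply: Hx; exact: cdD.
have mg' : measurable_fun `]c, d[ g.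
  by apply: measurable_funS mg => //; exact: open_measurable.
have gi := integrable_ae_bounded mg' M0 gM'.
(* The almost everywhere bound is only known inside D, which may omit c and d. Setting g to 0 off
   ]c, d[ extends the bound to [c, d] without changing integrals against test functions. *)
pose g' := g \_ `]c, d[.
have g'E x : c < x < d -> g' x = g x.
  by move=> xcd; rewrite /g' patchE mem_set//= in_itv.
apply: (@weak_taylor _ _ _ _ _ g') => //.
- exact: continuous_subspaceT.
- apply: integrable_cc_oo; apply: eq_integrable (integrable_sub_itv gi _) => //.
    by move=> x; rewrite inE /= in_itv/= => xcd; rewrite g'E.
  by apply: subset_itv; rewrite bnd_simp.
- apply: ae_lebesgue_impl gM' => x Hx _; have [xcd|xcd] := boolP (c < x < d).
    by rewrite g'E//; apply: Hx; rewrite /= in_itv.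
  by rewrite /g' patchE memNset ?normr0//= in_itv/=; exact/negP.
- move=> phi tphi; rewrite (weak_on_weak_derivative cdD ug tphi); congr (_ * _).
  apply: eq_Rintegral => x _; have [xcd|xcd] := boolP (c < x < d).
    by rewrite g'E.
  by rewrite (test_on_out tphi xcd) !mulr0.
Qed.

(** Applied on ]x - 1, x + 1[ around each point, so that interfaces are interior points; the local
    derivatives all coincide with [derive1 u], which is therefore continuous. *)
Lemma sobolev_infty_C1 (R : realType) (k : nat) (u : R -> R) : (0 < k)%N ->
  continuous u -> sobolev_infty [set: R] k.+1 u ->
  (forall x, derivable u x 1) /\ continuous (derive1 u).
Proof.
move=> k0 cu /(_ k.+1 (leqnn _))[g [ug gy]].
have [M M0 gM] : exists2 M : R, 0 <= M & (Lp_norm [set: R] +oo%E g <= M%:E)%E.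
  have := Lnorm_ge0 (@lebesgue_measure R) +oo%E (EFin \o (g \_ [set: R])).
  rewrite -/(Lp_norm _ _ _); move: gy.
  by case: (Lp_norm _ _ _) => [r _ r0| |//]; [exists r|rewrite ltxx].
have H (x : R) : exists F : R -> R, \forall y \near x, is_derive y (1:R) u (F y) /\
    {for y, continuous F}.
  have x1 : x - 1 < x + 1 by lra.
  have [F [P [_ HF]]] := weak_derivative_taylor x1 M0 k0 (@subsetT _ _) cu ug gM.
  exists F; near=> y.
  have /HF[dF cF _ _] : x - 1 < y < x + 1; last by split.
  by apply/andP; split; near: y; [apply: lt_nbhsr|apply: lt_nbhsl]; lra.
split=> x; first by have [F /nbhs_singleton[[]]] := H x.
have [F HF] := H x.
have FE : \near x, F x = derive1 u x.
  by near=> y; rewrite derive1E; have [[_ ->] _] : is_derive y (1:R) u (F y) /\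
    {for y, continuous F} by near: y.
have [_ cF] := nbhs_singleton HF.
rewrite /continuous_at -(nbhs_singleton FE).
exact: cvg_trans (near_eq_cvg FE) cF.
Unshelve. all: by end_near. Qed.

(** Two sources are combined: regularity on the line gives continuity of u and u_x up to the end
    points, while the remainders use the weak derivative selected on ]a, b[, whose norm is M. *)
Lemma sobolev_infty_taylor (R : realType) (a b M : R) (k : nat) (u : R -> R) :
  a < b -> (0 < k)%N -> continuous u -> sobolev_infty [set: R] k.+1 u ->
  sobolev_infty_seminorm `]a, b[ k.+1 u = M%:E ->
  forall c d, a <= c -> c < d -> d <= b -> exists2 P : {poly R}, (size P <= k.+1)%N &
    forall x, c <= x <= d -> `|u x - P.[x]| <= M * (d - c) ^+ k.+1 /\
      `|derive1 u x - P^`().[x]| <= M * (d - c) ^+ k.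
Proof.
move=> ab k0 cu su uM c d ac cd db.
have [du cu'] := sobolev_infty_C1 k0 cu su.
have ug : weak_derivative `]a, b[ k.+1 u
    (xget (cst 0 : R -> R) [set g | weak_derivative `]a, b[ k.+1 u g]).
  apply: (@xgetPex _ _ [set g | weak_derivative `]a, b[ k.+1 u g]).
  have [g [ug _]] := su _ (leqnn k.+1).
  by exists g; exact: weak_derivative_setT.
rewrite /sobolev_infty_seminorm in uM.
have M0 : 0 <= M by rewrite -lee_fin -uM; exact: Lnorm_ge0.
have sub : `]c, d[%classic `<=` (`]a, b[%classic : set R).
  by apply: subset_itv; rewrite bnd_simp.
have [|F [P [sP HF]]] := weak_derivative_taylor cd M0 k0 sub cu ug.
  by rewrite uM.
have cP (Q : {poly R}) : continuous (horner Q) by exact: continuous_horner.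
exists P => // x xcd; split.
  apply: (le_closed_itv (f := fun y => `|u y - P.[y]|) cd _ _ xcd); last first.
    by move=> y /HF[].
  by move=> y; apply: cvg_norm; apply: cvgB; [exact: cu|exact: cP].
apply: (le_closed_itv (f := fun y => `|derive1 u y - P^`().[y]|) cd _ _ xcd);
  last first.
  by move=> y /HF[[_ dF] _ _]; rewrite derive1E dF.
by move=> y; apply: cvg_norm; apply: cvgB; [exact: cu'|exact: cP].
Qed.

(** * Legendre polynomials on the unit interval *)

(* Rodrigues' formula: [(legendre R n).[t]] is the Legendre polynomial P_n(2t - 1). *)
Definition legendre (R : realType) (n : nat) : {poly R} := (('X^2 - 'X) ^+ n)^`N(n).

Lemma legendre_factor (R : realType) (n : nat) :
  ('X^2 - 'X) ^+ n = 'X^n * ('X - 1%:P) ^+ n :> {poly R}.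
Proof. by rewrite -exprMn mulrBr mulr1 -expr2. Qed.

Lemma coef_legendre (R : realType) (n i : nat) :
  (legendre R n)`_i = (('X - 1%:P) ^+ n : {poly R})`_i *+ 'C(n + i, n).
Proof.
rewrite /legendre coef_nderivn legendre_factor coefXnM.
by rewrite ltnNge leq_addr /= addKn.
Qed.

Lemma size_legendre (R : realType) (n : nat) : (size (legendre R n) <= n.+1)%N.
Proof.
apply/leq_sizeP => i ni; rewrite coef_legendre nth_default ?mul0rn//.
by rewrite size_exp_XsubC.
Qed.

Lemma coef_legendre_neq0 (R : realType) (n : nat) : (legendre R n)`_n != 0.
Proof.
rewrite coef_legendre.
have -> : (('X - 1%:P) ^+ n : {poly R})`_n = 1.
  have := lead_coef_exp ('X - 1%:P : {poly R}) n.
  by rewrite lead_coefXsubC expr1n lead_coefE size_exp_XsubC.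
by rewrite pnatr_eq0 -lt0n bin_gt0 leq_addr.
Qed.

Lemma legendre_at0 (R : realType) (n : nat) : (legendre R n).[0] = (-1) ^+ n.
Proof.
rewrite horner_coef0 coef_legendre addn0 binn mulr1n -horner_coef0.
by rewrite horner_exp !hornerE.
Qed.

Lemma deriv_legendre_at0 (R : realType) (n : nat) :
  (legendre R n)^`().[0] = - (-1) ^+ n * (n%:R * n.+1%:R).
Proof.
rewrite horner_coef0 coef_deriv mulr1n coef_legendre addn1 binSn.
(* The sign is written - (-1)^n instead of (-1)^(n-1), so that n = 0 is covered. *)
have -> : (('X - 1%:P) ^+ n : {poly R})`_1 = - (-1) ^+ n * n%:R.
  have -> : (('X - 1%:P) ^+ n : {poly R})`_1 = (('X - 1%:P) ^+ n)^`().[0].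
    by rewrite horner_coef0 coef_deriv mulr1n.
  case: n => [|n]; first by rewrite expr0 derivC horner0 mulr0.
  rewrite deriv_exp derivB derivX derivC subr0 mul1r hornerMn horner_exp !hornerE.
  by rewrite -mulr_natr exprS /=; ring.
by rewrite -[LHS]mulr_natr mulrA.
Qed.

Lemma derivn_comp_reflect (R : realType) (p : {poly R}) (n : nat) :
  (p \Po (1%:P - 'X))^`(n) = (-1) ^+ n *: (p^`(n) \Po (1%:P - 'X)).
Proof.
elim: n => [|n IH]; first by rewrite expr0 scale1r.
rewrite !derivnS IH derivZ deriv_comp derivB derivC derivX sub0r.
by rewrite mulrN1 scalerN exprS mulN1r scaleNr.
Qed.

(** Since t^2 - t is invariant under t -> 1 - t, values at 1 follow from values at 0, and these are
    plain coefficients. *)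
Lemma derivn_bubble_reflect (R : realType) (n m : nat) (x : R) :
  (('X^2 - 'X) ^+ n)^`(m).[1 - x] = (-1) ^+ m * (('X^2 - 'X) ^+ n)^`(m).[x].
Proof.
have E : ('X^2 - 'X : {poly R}) ^+ n = ('X^2 - 'X) ^+ n \Po (1%:P - 'X).
  rewrite rmorphXn /=; congr (_ ^+ _).
  by rewrite rmorphB rmorphXn /= comp_polyX; ring.
rewrite {1}E derivn_comp_reflect hornerZ horner_comp !hornerE.
by congr (_ * (_ .[ _ ])); ring.
Qed.

Lemma legendre_at1 (R : realType) (n : nat) : (legendre R n).[1] = 1.
Proof.
have f0 : n`!%:R != 0 :> R by rewrite pnatr_eq0 -lt0n fact_gt0.
apply: (mulIf f0); rewrite mulr_natr -hornerMn -nderivn_def.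
rewrite -[X in _.[X]](subr0 1) derivn_bubble_reflect nderivn_def hornerMn.
by rewrite -/(legendre R n) legendre_at0 -mulr_natr mulrA -expr2 sqrr_sign.
Qed.

Lemma deriv_legendre_at1 (R : realType) (n : nat) :
  (legendre R n)^`().[1] = n%:R * n.+1%:R.
Proof.
have f0 : n`!%:R != 0 :> R by rewrite pnatr_eq0 -lt0n fact_gt0.
apply: (mulIf f0); rewrite [LHS]mulr_natr -hornerMn -derivMn -nderivn_def -derivnS.
rewrite -[X in _.[X]](subr0 1) derivn_bubble_reflect derivnS nderivn_def derivMn.
rewrite hornerMn -/(legendre R n) deriv_legendre_at0 -[X in _ * X]mulr_natr mulrA exprS.
have S2 : (-1) ^+ n * (-1) ^+ n = 1 :> R by rewrite -expr2 sqrr_sign.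
transitivity ((-1) ^+ n * (-1) ^+ n * (n%:R * n.+1%:R * n`!%:R) : R); first by ring.
by rewrite S2 mul1r.
Qed.

Definition unit_integral (R : realType) (p : {poly R}) : R :=
  \int[@lebesgue_measure R]_(x in `[0, 1]) p.[x].

Lemma unit_integral_parts (R : realType) (p q : {poly R}) :
  p.[0] = 0 -> p.[1] = 0 ->
  unit_integral (p^`() * q) = - unit_integral (p * q^`()).
Proof.
move=> p0 p1; apply/eqP; rewrite -addr_eq0 -RintegralD//; last 2 first.
- by apply: integrable_contT; exact: continuous_horner.
- by apply: integrable_contT; exact: continuous_horner.
under eq_Rintegral => x _ do rewrite -hornerD.
by rewrite (Rintegral_horner ler01 (derivM p q)) !hornerM p0 p1 !mul0r subrr.
Qed.

Lemma unit_integral_partsn (R : realType) (p q : {poly R}) (m : nat) :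
  (forall j, (j < m)%N -> p^`(j).[0] = 0) ->
  (forall j, (j < m)%N -> p^`(j).[1] = 0) ->
  unit_integral (p^`(m) * q) = (-1) ^+ m * unit_integral (p * q^`(m)).
Proof.
elim: m q => [|m IH] q p0 p1; first by rewrite expr0 mul1r.
rewrite derivnS unit_integral_parts ?p0 ?p1// IH.
- by rewrite exprS mulN1r mulNr derivSn.
- by move=> j jm; apply: p0; exact: ltnW.
- by move=> j jm; apply: p1; exact: ltnW.
Qed.

Lemma derivn_bubble_at0 (R : realType) (n m : nat) : (m < n)%N ->
  (('X^2 - 'X : {poly R}) ^+ n)^`(m).[0] = 0.
Proof.
move=> mn; rewrite horner_coef0 coef_derivn addn0 legendre_factor coefXnM mn.
by rewrite mul0rn.
Qed.

Lemma derivn_bubble_at1 (R : realType) (n m : nat) : (m < n)%N ->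
  (('X^2 - 'X : {poly R}) ^+ n)^`(m).[1] = 0.
Proof.
move=> mn; rewrite -[X in _.[X]](subr0 1) derivn_bubble_reflect.
by rewrite derivn_bubble_at0 ?mulr0.
Qed.

Lemma unit_integral0 (R : realType) : unit_integral (0 : {poly R}) = 0.
Proof. by apply: Rintegral_eq0 => x _; rewrite horner0. Qed.

Lemma unit_integralZ (R : realType) (k : R) (p : {poly R}) :
  unit_integral (k *: p) = k * unit_integral p.
Proof.
rewrite -RintegralZl//; last by apply: integrable_contT; exact: continuous_horner.
by apply: eq_Rintegral => x _; rewrite hornerZ.
Qed.

(** After n integrations by parts, whose boundary terms vanish because t^2 - t is 0 at both ends,
    the n-th derivative falls on q and kills it. *)
Lemma legendre_orthogonal_low (R : realType) (n : nat) (q : {poly R}) :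
  (size q <= n)%N -> unit_integral (legendre R n * q) = 0.
Proof.
move=> qn; have f0 : n`!%:R != 0 :> R by rewrite pnatr_eq0 -lt0n fact_gt0.
apply: (mulfI f0); rewrite mulr0 -unit_integralZ scalerAl scaler_nat -nderivn_def.
rewrite unit_integral_partsn ?(derivn_poly0 qn) ?mulr0 ?unit_integral0 ?mulr0//.
  exact: derivn_bubble_at0.
exact: derivn_bubble_at1.
Qed.

Lemma legendre_orthogonal (R : realType) (m n : nat) : m != n ->
  unit_integral (legendre R m * legendre R n) = 0.
Proof.
case: (ltngtP m n) => // mn _.
  by rewrite mulrC legendre_orthogonal_low// (leq_trans (size_legendre _ _)).
by rewrite legendre_orthogonal_low// (leq_trans (size_legendre _ _)).
Qed.

Lemma poly_eq0_unit_itv (R : realType) (p : {poly R}) :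
  (forall x, 0 < x < 1 -> p.[x] = 0) -> p = 0.
Proof.
move=> p0; apply/eqP; apply: contraT => pn0.
(* The points 1/2, 1/3, ... of ]0, 1[: as many distinct roots as [size p], which is one more than
   the degree allows. *)
pose rs : seq R := [seq i.+2%:R^-1 | i <- iota 0 (size p)].
have := max_poly_roots (rs := rs) pn0; rewrite size_map size_iota ltnn => -> //.
  apply/allP => _ /mapP[i _ ->]; apply/rootP; apply: p0.
  by rewrite invr_gt0 ltr0n invf_lt1 ?ltr0n// ltr1n.
rewrite map_inj_uniq ?iota_uniq// => i j /invr_inj/eqP.
by rewrite eqr_nat => /eqP[].
Qed.

(** A primitive P of p^2 is nondecreasing; if the integral were 0, P would be constant on [0, 1],
    hence a constant polynomial, and p^2 = P' = 0. *)
Lemma unit_integral_sqr_gt0 (R : realType) (p : {poly R}) : p != 0 ->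
  0 < unit_integral (p ^+ 2).
Proof.
move=> pn0.
have ge0 : 0 <= unit_integral (p ^+ 2).
  by apply: Rintegral_ge0 => x _; rewrite horner_exp sqr_ge0.
rewrite lt_neqAle ge0 andbT; apply: contra pn0 => /eqP I0.
have [P _ dP] := poly_antiderivative (p ^+ 2).
have P01 : P.[1] - P.[0] = 0 by rewrite -(Rintegral_horner ler01 dP) [RHS]I0.
have Pd z : is_derive z (1:R) (horner P) (p ^+ 2).[z].
  by rewrite -dP; exact: is_derive_poly.
have incr x y : x < y -> P.[x] <= P.[y].
  move=> xy; have [z _ E] := MVT_is_derive xy Pd.
  by rewrite -subr_ge0 E horner_exp mulr_ge0 ?sqr_ge0// subr_ge0 ltW.
suff P0 : P - (P.[0])%:P = 0.
  have : (p ^+ 2) = 0.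
    by rewrite -dP -[P](subrK (P.[0])%:P) P0 add0r derivC.
  by move/eqP; rewrite expf_eq0.
apply: poly_eq0_unit_itv => x /andP[x0 x1].
rewrite hornerD hornerN hornerC; apply/eqP; rewrite subr_eq0.
have h0 := incr _ _ x0; have h1 := incr _ _ x1.
by rewrite eq_le h0 andbT; lra.
Qed.

Lemma legendre_neq0 (R : realType) (n : nat) : legendre R n != 0.
Proof. by apply: contra (coef_legendre_neq0 R n) => /eqP ->; rewrite coef0. Qed.

Lemma legendre_span (R : realType) (m : nat) (q : {poly R}) : (size q <= m)%N ->
  exists c : nat -> R, q = \sum_(i < m) c i *: legendre R i.
Proof.
elim: m q => [|m IH] q qm.
  exists (fun=> 0); rewrite big_ord0; apply/eqP.
  by rewrite -size_poly_eq0 -leqn0.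
pose t := q`_m / (legendre R m)`_m.
have [|c Hc] := IH (q - t *: legendre R m).
  apply/leq_sizeP => j; rewrite leq_eqVlt => /predU1P[<-|mj].
    by rewrite coefB coefZ divfK ?subrr// coef_legendre_neq0.
  rewrite coefB coefZ !nth_default ?mulr0 ?subrr//.
    exact: leq_trans (size_legendre _ _) _.
  exact: leq_trans qm _.
exists (fun i => if i == m then t else c i).
rewrite big_ord_recr /= eqxx; under eq_bigr => i _ do rewrite ltn_eqF//.
by rewrite -Hc subrK.
Qed.

(** * The interface conditions *)

(* [A- (v0, v1) = 0] and [A+ (v0, v1) = 0]: the conditions at the right and at the
   left end of a cell. *)
Definition right_conditions (R : realType) (al b1 b2 v0 v1 : R) : Prop :=
  (2^-1 + al) * v0 = b2 * v1 /\ b1 * v0 = (2^-1 - al) * v1.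

Definition left_conditions (R : realType) (al b1 b2 v0 v1 : R) : Prop :=
  (2^-1 - al) * v0 + b2 * v1 = 0 /\ b1 * v0 + (2^-1 + al) * v1 = 0.

Lemma interface_split (R : realType) (al b1 b2 p0 p1 m0 m1 z0 z1 : R) :
  al ^+ 2 + b1 * b2 = 4^-1 ->
  2^-1 * (p0 + m0) - al * (p0 - m0) + b2 * (p1 - m1) = z0 /\
  2^-1 * (p1 + m1) + al * (p1 - m1) + b1 * (p0 - m0) = z1 <->
  left_conditions al b1 b2 (p0 - z0) (p1 - z1) /\
  right_conditions al b1 b2 (m0 - z0) (m1 - z1).
Proof.
move=> H; rewrite /left_conditions /right_conditions; split; last first.
  by move=> [[L1 L2] [R1 R2]]; split; lra.
move=> [E0 E1]; pose c := 2^-1 - al; pose d := 2^-1 + al.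
have cd : c * d = b1 * b2 by rewrite /c /d; nra.
pose P0 := p0 - z0; pose P1 := p1 - z1; pose M0 := m0 - z0; pose M1 := m1 - z1.
have F0 : c * P0 + b2 * P1 + (d * M0 - b2 * M1) = 0.
  by rewrite /c /d /P0 /P1 /M0 /M1; lra.
have F1 : b1 * P0 + d * P1 + (c * M1 - b1 * M0) = 0.
  by rewrite /c /d /P0 /P1 /M0 /M1; lra.
have cd1 : d = 1 - c by rewrite /c /d; lra.
have L1 : c * P0 + b2 * P1 = 0.
  (* First row of [A+] applied to the summed condition. The corrections carry the factors c d - b1
     b2 and 1 - c - d, which vanish: these are [A+ A- = 0] and [A+ A+ = A+]. *)
  have -> : c * P0 + b2 * P1 = c * (c * P0 + b2 * P1 + (d * M0 - b2 * M1)) +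
     b2 * (b1 * P0 + d * P1 + (c * M1 - b1 * M0)) +
     (c * d - b1 * b2) * (P0 - M0) + (1 - c - d) * (c * P0 + b2 * P1) by ring.
  by rewrite F0 F1 cd cd1; ring.
have L2 : b1 * P0 + d * P1 = 0.
  have -> : b1 * P0 + d * P1 = b1 * (c * P0 + b2 * P1 + (d * M0 - b2 * M1)) +
     d * (b1 * P0 + d * P1 + (c * M1 - b1 * M0)) +
     (c * d - b1 * b2) * (P1 - M1) + (1 - c - d) * (b1 * P0 + d * P1) by ring.
  by rewrite F0 F1 cd cd1; ring.
rewrite -/c -/d -/P0 -/P1 -/M0 -/M1; split; split; lra.
Qed.

Lemma cramer2 (R : realType) (A B C D r t x y : R) : A * D + B * C != 0 ->
  (A * x + B * y = r /\ D * y - C * x = t) <->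
  (x * (A * D + B * C) = r * D - t * B /\ y * (A * D + B * C) = r * C + t * A).
Proof.
move=> det; split=> [[<- <-]|[Ex Ey]]; first by split; ring.
split; apply: (mulIf det).
- transitivity (A * (x * (A * D + B * C)) + B * (y * (A * D + B * C))); first by ring.
  by rewrite Ex Ey; ring.
- transitivity (D * (y * (A * D + B * C)) - C * (x * (A * D + B * C))); first by ring.
  by rewrite Ex Ey; ring.
Qed.

(** Here x and y stand for the last two coefficients, K' and K for the slopes of their basis
    functions at the right end, s for the parity sign at the left end. As c d = b1 b2, each pair of
    conditions reduces to its row starting with b1 if b1 is nonzero, to the other row otherwise.
    Cramer's rule gives the determinant 2 b1 G or 2 b2 G, and c d = b1 b2 shows that b1 or b2 also
    divides the numerators, so both cases end in the same formula. *)
Lemma pstar_solve (R : realType) (al b1 b2 K K' s r0 r1 l0 l1 x y : R) :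
  let c := 2^-1 - al in let d := 2^-1 + al in
  let G := b1 - (K + K') / 2 + b2 * (K * K') in
  al ^+ 2 + b1 * b2 = 4^-1 -> b1 != 0 \/ b2 != 0 -> s ^+ 2 = 1 -> G != 0 ->
  (right_conditions al b1 b2 (x + y - r0) (x * K' + y * K - r1) /\
   left_conditions al b1 b2 (s * (y - x) - l0) (s * (x * K' - y * K) - l1)) <->
  (2 * G * x = (b1 * r0 - c * r1 - d * K * r0 + b2 * K * r1)
             - s * (b1 * l0 + d * l1 - c * K * l0 - b2 * K * l1) /\
   2 * G * y = (b1 * r0 - c * r1 - d * K' * r0 + b2 * K' * r1)
             + s * (b1 * l0 + d * l1 - c * K' * l0 - b2 * K' * l1)).
Proof.
move=> c d G H b12 s2 Gn0; rewrite /right_conditions /left_conditions -/c -/d.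
have cd : c * d = b1 * b2 by rewrite /c /d; nra.
have cd1 : d = 1 - c by rewrite /c /d; lra.
clearbody c d.
have s2' : s * s = 1 by rewrite -s2.
have two0 : (2:R) != 0 by rewrite pnatr_eq0.
have slin u v : s * u - v = 0 <-> u = s * v.
  split=> [/eqP|->]; last by rewrite mulrA s2' mul1r subrr.
  by rewrite subr_eq0 => /eqP <-; rewrite mulrA s2' mul1r.
have [b1e0|b1n0] := eqVneq b1 0; last first.
- have det : (b1 - c * K') * (b1 - d * K) + (b1 - c * K) * (b1 - d * K') = 2 * b1 * G.
    have -> : (b1 - c * K') * (b1 - d * K) + (b1 - c * K) * (b1 - d * K') =
      2 * b1 ^+ 2 - b1 * ((c + d) * (K + K')) + 2 * (c * d) * (K * K') by ring.
    by rewrite cd cd1 /G; field.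
  have det0 : (b1 - c * K') * (b1 - d * K) + (b1 - c * K) * (b1 - d * K') != 0.
    by rewrite det !mulf_neq0.
  have row_r v0 v1 : d * v0 = b2 * v1 /\ b1 * v0 = c * v1 <-> b1 * v0 = c * v1.
    split=> [[]//|e]; split=> //; apply: (mulfI b1n0).
    by rewrite mulrCA e !mulrA -cd; ring.
  have row_l v0 v1 : c * v0 + b2 * v1 = 0 /\ b1 * v0 + d * v1 = 0 <->
      b1 * v0 + d * v1 = 0.
    split=> [[]//|e]; split=> //; apply: (mulfI b1n0); rewrite mulr0.
    have -> : b1 * (c * v0 + b2 * v1) =
      c * (b1 * v0 + d * v1) - (c * d - b1 * b2) * v1 by ring.
    by rewrite e cd subrr mulr0 mul0r subrr.
  have e1 : b1 * (x + y - r0) = c * (x * K' + y * K - r1) <->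
      (b1 - c * K') * x + (b1 - c * K) * y = b1 * r0 - c * r1.
    by split=> e; lra.
  have e2 : b1 * (s * (y - x) - l0) + d * (s * (x * K' - y * K) - l1) = 0 <->
      (b1 - d * K) * y - (b1 - d * K') * x = s * (b1 * l0 + d * l1).
    rewrite -slin; have -> : b1 * (s * (y - x) - l0) + d * (s * (x * K' - y * K) - l1) =
      s * ((b1 - d * K) * y - (b1 - d * K') * x) - (b1 * l0 + d * l1) by ring.
    by [].
  rewrite row_r row_l e1 e2 (cramer2 _ _ _ _ det0) det.
  have canc X n m : b1 * m = n -> X * (2 * b1 * G) = n <-> 2 * G * X = m.
    move=> <-; split=> [e|<-]; last by ring.
    by apply: (mulfI b1n0); rewrite -e; ring.
  rewrite (canc _ _ ((b1 * r0 - c * r1 - d * K * r0 + b2 * K * r1)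
             - s * (b1 * l0 + d * l1 - c * K * l0 - b2 * K * l1))); last first.
    apply/eqP; rewrite -subr_eq0; apply/eqP.
    transitivity ((b1 * b2 - c * d) * K * (r1 + s * l1)); first by ring.
    by rewrite cd subrr !mul0r.
  rewrite (canc _ _ ((b1 * r0 - c * r1 - d * K' * r0 + b2 * K' * r1)
             + s * (b1 * l0 + d * l1 - c * K' * l0 - b2 * K' * l1))) //.
  apply/eqP; rewrite -subr_eq0; apply/eqP.
  transitivity ((b1 * b2 - c * d) * K' * (r1 - s * l1)); first by ring.
  by rewrite cd subrr !mul0r.
- have b2n0 : b2 != 0 by case: b12 => //; rewrite b1e0 eqxx.
  have det : (d - b2 * K') * (c - b2 * K) + (d - b2 * K) * (c - b2 * K') = 2 * b2 * G.
    have -> : (d - b2 * K') * (c - b2 * K) + (d - b2 * K) * (c - b2 * K') =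
      2 * (c * d) - b2 * ((c + d) * (K + K')) + 2 * b2 ^+ 2 * (K * K') by ring.
    by rewrite cd cd1 /G; field.
  have det0 : (d - b2 * K') * (c - b2 * K) + (d - b2 * K) * (c - b2 * K') != 0.
    by rewrite det !mulf_neq0.
  have row_r v0 v1 : d * v0 = b2 * v1 /\ b1 * v0 = c * v1 <-> d * v0 = b2 * v1.
    split=> [[]//|e]; split=> //; apply: (mulfI b2n0).
    by rewrite mulrA [b2 * b1]mulrC -cd -mulrA e; ring.
  have row_l v0 v1 : c * v0 + b2 * v1 = 0 /\ b1 * v0 + d * v1 = 0 <->
      c * v0 + b2 * v1 = 0.
    split=> [[]//|e]; split=> //; apply: (mulfI b2n0); rewrite mulr0.
    have -> : b2 * (b1 * v0 + d * v1) =
      d * (c * v0 + b2 * v1) - (c * d - b1 * b2) * v0 by ring.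
    by rewrite e cd subrr mulr0 mul0r subrr.
  have e1 : d * (x + y - r0) = b2 * (x * K' + y * K - r1) <->
      (d - b2 * K') * x + (d - b2 * K) * y = d * r0 - b2 * r1.
    by split=> e; lra.
  have e2 : c * (s * (y - x) - l0) + b2 * (s * (x * K' - y * K) - l1) = 0 <->
      (c - b2 * K) * y - (c - b2 * K') * x = s * (c * l0 + b2 * l1).
    rewrite -slin; have -> : c * (s * (y - x) - l0) + b2 * (s * (x * K' - y * K) - l1) =
      s * ((c - b2 * K) * y - (c - b2 * K') * x) - (c * l0 + b2 * l1) by ring.
    by [].
  rewrite row_r row_l e1 e2 (cramer2 _ _ _ _ det0) det.
  have canc X n m : b2 * m = n -> X * (2 * b2 * G) = n <-> 2 * G * X = m.
    move=> <-; split=> [e|<-]; last by ring.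
    by apply: (mulfI b2n0); rewrite -e; ring.
  rewrite (canc _ _ ((b1 * r0 - c * r1 - d * K * r0 + b2 * K * r1)
             - s * (b1 * l0 + d * l1 - c * K * l0 - b2 * K * l1))); last first.
    apply/eqP; rewrite -subr_eq0; apply/eqP.
    transitivity ((b1 * b2 - c * d) * (r0 - s * l0)); first by ring.
    by rewrite cd subrr mul0r.
  rewrite (canc _ _ ((b1 * r0 - c * r1 - d * K' * r0 + b2 * K' * r1)
             + s * (b1 * l0 + d * l1 - c * K' * l0 - b2 * K' * l1))) //.
  apply/eqP; rewrite -subr_eq0; apply/eqP.
  transitivity ((b1 * b2 - c * d) * (r0 + s * l0)); first by ring.
  by rewrite cd subrr mul0r.
Qed.

(** * Bounds for the last two Legendre coefficients *)

Lemma inv_size_le (R : realType) (b1 b2 q h W : R) : 0 < h -> 1 <= q ->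
  `|b1| <= W -> `|b2| / h ^+ 2 <= W ->
  h^-1 <= `|b1 - q ^+ 2 / h + b2 * (q ^+ 2 * (q ^+ 2 - 1) / h ^+ 2)| + (1 + q ^+ 4) * W.
Proof.
move=> h0 q1 b1W b2W; set G := b1 - _ + _.
have q21 : 1 <= q ^+ 2 by rewrite exprn_ege1.
have q0 : 0 <= q ^+ 2 * (q ^+ 2 - 1) by rewrite mulr_ge0 ?subr_ge0// sqr_ge0.
have hi0 : 0 <= h^-1 by rewrite invr_ge0 ltW.
have E : q ^+ 2 / h = b1 - G + b2 / h ^+ 2 * (q ^+ 2 * (q ^+ 2 - 1)).
  by rewrite /G; field; rewrite gt_eqF.
apply: (@le_trans _ _ (q ^+ 2 / h)); first by rewrite ler_peMl.
rewrite E; have H1 := ler_norm b1; have H2 := ler_norm (- G); rewrite normrN in H2.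
have H3 : b2 / h ^+ 2 * (q ^+ 2 * (q ^+ 2 - 1)) <= q ^+ 4 * W.
  apply: (@le_trans _ _ (W * (q ^+ 2 * (q ^+ 2 - 1)))).
    rewrite ler_wpM2r// (le_trans _ b2W)// ler_wpM2r ?ler_norm//.
    by rewrite invr_ge0 sqr_ge0.
  rewrite mulrC ler_wpM2r ?(le_trans _ b1W)//.
  have -> : q ^+ 4 = q ^+ 2 * q ^+ 2 by ring.
  by rewrite ler_wpM2l ?sqr_ge0//; lra.
by rewrite mulrDl mul1r; lra.
Qed.

(** Values scale like Z, derivatives like Z / h and K like 1 / h: each term is Z times one of the
    quantities |b1|, |c| / h, |d| / h, |b2| / h^2. *)
Lemma numerator_bound (R : realType) (c d b1 b2 K r0 r1 Z kap h : R) :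
  0 < h -> 0 <= K -> K <= kap / h -> `|r0| <= Z -> `|r1| <= Z / h ->
  `|b1 * r0 - c * r1 - d * K * r0 + b2 * K * r1| <=
    Z * (`|b1| + `|c| / h + kap * (`|d| / h) + kap * (`|b2| / h ^+ 2)).
Proof.
move=> h0 K0 Kk r0Z r1Z.
have Z0 : 0 <= Z by exact: le_trans r0Z.
have T1 : `|b1 * r0| <= Z * `|b1| by rewrite normrM mulrC ler_wpM2r.
have T2 : `|c * r1| <= Z * (`|c| / h).
  by rewrite normrM mulrCA ler_wpM2l.
have T3 : `|d * K * r0| <= Z * (kap * (`|d| / h)).
  rewrite !normrM (ger0_norm K0) mulrC; apply: ler_pM => //.
    by rewrite mulr_ge0.
  by rewrite mulrCA ler_wpM2l.
have T4 : `|b2 * K * r1| <= Z * (kap * (`|b2| / h ^+ 2)).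
  rewrite !normrM (ger0_norm K0).
  have -> : Z * (kap * (`|b2| / h ^+ 2)) = `|b2| * (kap / h) * (Z / h).
    by field; rewrite gt_eqF.
  by apply: ler_pM => //; [rewrite mulr_ge0|rewrite ler_wpM2l].
rewrite !mulrDr.
apply: (le_trans (ler_normD _ _)); apply: lerD => //.
apply: (le_trans (ler_normB _ _)); apply: lerD => //.
by apply: (le_trans (ler_normB _ _)); apply: lerD.
Qed.

(** Here q is k. In 5 + q^4, the 2 comes from the terms in b1 and b2 of the two numerators, and 3 +
    q^4 from (|c| + |d|) / h: 1 + q^4 for 1 / h and 2 for twice the minimum. The bound on 1 / h also
    contains |G|, and after division by |G| it produces the summand 1 in 1 + W / |G|. *)
Lemma solution_bound (R : realType) (al b1 b2 K s r0 r1 l0 l1 Z q h W x : R) :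
  let c := 2^-1 - al in let d := 2^-1 + al in
  let G := b1 - q ^+ 2 / h + b2 * (q ^+ 2 * (q ^+ 2 - 1) / h ^+ 2) in
  let kap := q * (q + 1) in
  0 < h -> 1 <= q -> G != 0 -> 0 <= K -> K <= kap / h -> `|s| = 1 ->
  `|r0| <= Z -> `|r1| <= Z / h -> `|l0| <= Z -> `|l1| <= Z / h ->
  `|b1| <= W -> Num.min (`|c| / h) (`|d| / h) <= W -> `|b2| / h ^+ 2 <= W ->
  2 * G * x = (b1 * r0 - c * r1 - d * K * r0 + b2 * K * r1)
            + s * (b1 * l0 + d * l1 - c * K * l0 - b2 * K * l1) ->
  `|x| <= (1 + kap) * (5 + q ^+ 4) * Z * (1 + W / `|G|).
Proof.
move=> c d G kap h0 q1 G0 K0 Kk s1 r0Z r1Z l0Z l1Z b1W cdW b2W E.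
have Z0 : 0 <= Z by exact: le_trans r0Z.
have W0 : 0 <= W by exact: le_trans b1W.
have kap0 : 0 <= kap by rewrite mulr_ge0 ?addr_ge0// (le_trans _ q1).
have ic : h^-1 <= `|G| + (1 + q ^+ 4) * W by exact: inv_size_le.
have hi0 : 0 < h^-1 by rewrite invr_gt0.
have cd1 : `|c| / h + `|d| / h <= `|G| + (3 + q ^+ 4) * W.
  suff: `|c| / h + `|d| / h <= h^-1 + 2 * W by rewrite !mulrDl !mul1r in ic *; lra.
  have d1 : `|d| <= 1 + `|c|.
    rewrite (_ : d = 1 - c); last by rewrite /c /d; lra.
    by rewrite (le_trans (ler_normB _ _))// normr1.
  have c1 : `|c| <= 1 + `|d|.
    rewrite (_ : c = 1 - d); last by rewrite /c /d; lra.
    by rewrite (le_trans (ler_normB _ _))// normr1.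
  have d2 : `|d| / h <= h^-1 + `|c| / h.
    by rewrite -[X in X + _]mul1r -mulrDl ler_wpM2r// ltW.
  have c2 : `|c| / h <= h^-1 + `|d| / h.
    by rewrite -[X in X + _]mul1r -mulrDl ler_wpM2r// ltW.
  by move: cdW; rewrite ge_min => /orP[] H; lra.
have B1 := numerator_bound c d b1 b2 h0 K0 Kk r0Z r1Z.
have B2 : `|b1 * l0 + d * l1 - c * K * l0 - b2 * K * l1| <=
    Z * (`|b1| + `|d| / h + kap * (`|c| / h) + kap * (`|b2| / h ^+ 2)).
  (* The left numerator is the right one with c and d exchanged and l1 changed in sign. *)
  have l1Z' : `|- l1| <= Z / h by rewrite normrN.
  have := numerator_bound d c b1 b2 h0 K0 Kk l0Z l1Z'.
  by rewrite !mulrN opprK.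
have B : `|2 * G * x| <= Z * ((1 + kap) * (5 + q ^+ 4) * (`|G| + W)).
  rewrite E (le_trans (ler_normD _ _))// normrM s1 mul1r.
  apply: (le_trans (lerD B1 B2)); rewrite -mulrDr ler_wpM2l//.
  apply: (@le_trans _ _ ((1 + kap) * (2 * W + (`|c| / h + `|d| / h)))).
    have : kap * (`|b2| / h ^+ 2) <= kap * W by rewrite ler_wpM2l.
    rewrite !mulrDl !mul1r !mulrDr; lra.
  rewrite -mulrA ler_wpM2l ?addr_ge0//.
  have q40 : 0 <= q ^+ 4 by rewrite exprn_ge0// (le_trans _ q1).
  have : 0 <= q ^+ 4 * `|G| by rewrite mulr_ge0.
  have := normr_ge0 G; move: cd1; rewrite !mulrDl !mulrDr; lra.
have Gp : 0 < `|G| by rewrite normr_gt0.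
rewrite -(ler_pM2l Gp).
have -> : `|G| * ((1 + kap) * (5 + q ^+ 4) * Z * (1 + W / `|G|)) =
  Z * ((1 + kap) * (5 + q ^+ 4) * (`|G| + W)) by field; rewrite gt_eqF.
apply: le_trans B; rewrite !normrM (ger0_norm (ler0n _ 2)).
by rewrite -mulrA ler_peMl ?mulr_ge0// ler1n.
Qed.

(** * The projection on one cell *)

Definition cell_basis (R : realType) (l r : R) (n : nat) : {poly R} :=
  legendre R n \Po ((r - l)^-1 *: ('X - l%:P)).

Lemma horner_cell_basis (R : realType) (l r : R) (n : nat) (y : R) :
  (cell_basis l r n).[y] = (legendre R n).[(y - l) / (r - l)].
Proof. by rewrite horner_comp hornerZ hornerXsubC mulrC. Qed.

Lemma horner_deriv_cell_basis (R : realType) (l r : R) (n : nat) (y : R) :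
  (cell_basis l r n)^`().[y] = (legendre R n)^`().[(y - l) / (r - l)] / (r - l).
Proof.
rewrite deriv_comp derivZ derivXsubC hornerM horner_comp.
by rewrite !hornerZ hornerXsubC hornerC mulr1 [X in _.[X]]mulrC.
Qed.

Lemma cell_basis_left (R : realType) (l r : R) (n : nat) :
  (cell_basis l r n).[l] = (-1) ^+ n.
Proof. by rewrite horner_cell_basis subrr mul0r legendre_at0. Qed.

Lemma cell_basis_right (R : realType) (l r : R) (n : nat) : l < r ->
  (cell_basis l r n).[r] = 1.
Proof.
by move=> lr; rewrite horner_cell_basis divff ?subr_eq0 ?gt_eqF// legendre_at1.
Qed.

Lemma deriv_cell_basis_left (R : realType) (l r : R) (n : nat) :
  (cell_basis l r n)^`().[l] = - (-1) ^+ n * (n%:R * n.+1%:R / (r - l)).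
Proof.
by rewrite horner_deriv_cell_basis subrr mul0r deriv_legendre_at0 !mulrA.
Qed.

Lemma deriv_cell_basis_right (R : realType) (l r : R) (n : nat) : l < r ->
  (cell_basis l r n)^`().[r] = n%:R * n.+1%:R / (r - l).
Proof.
move=> lr; rewrite horner_deriv_cell_basis divff ?subr_eq0 ?gt_eqF//.
by rewrite deriv_legendre_at1.
Qed.

Lemma size_cell_basis (R : realType) (l r : R) (n : nat) : l < r ->
  (size (cell_basis l r n) <= n.+1)%N.
Proof.
move=> lr; rewrite size_comp_poly2 ?size_legendre//.
by rewrite size_scale ?size_XsubC// invr_eq0 subr_eq0 gt_eqF.
Qed.

Lemma cell_basis_span (R : realType) (l r : R) (m : nat) (q : {poly R}) : l < r ->
  (size q <= m)%N -> exists c : nat -> R, q = \sum_(i < m) c i *: cell_basis l r i.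
Proof.
move=> lr qm; have h0 : r - l != 0 by rewrite subr_eq0 gt_eqF.
have [|c qc] := @legendre_span R m (q \Po ((r - l) *: 'X + l%:P)).
  rewrite size_comp_poly2//.
  by rewrite size_polyDl size_scale ?size_polyX// ltnS size_polyC_leq1.
exists c.
transitivity ((q \Po ((r - l) *: 'X + l%:P)) \Po ((r - l)^-1 *: ('X - l%:P))).
  rewrite -comp_polyA comp_polyD comp_polyZ comp_polyX comp_polyC scalerA divff//.
  by rewrite scale1r subrK comp_polyXr.
rewrite qc raddf_sum; apply: eq_bigr => i _.
by rewrite /= comp_polyZ.
Qed.

Definition moment (R : realType) (l r : R) (f : R -> R) (v : {poly R}) : R :=
  \int[@lebesgue_measure R]_(y in `[l, r]) (f y * v.[y]).

Lemma integrable_mul_horner (R : realType) (l r : R) (f : R -> R) (v : {poly R}) :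
  (@lebesgue_measure R).-integrable `[l, r] (EFin \o f) ->
  (@lebesgue_measure R).-integrable `[l, r] (EFin \o (fun y => f y * v.[y])).
Proof. by move=> fi; apply: integrable_mul_cont => //; exact: continuous_horner. Qed.

Lemma moment_sum (R : realType) (l r : R) (f : R -> R) (m : nat) (a : nat -> R)
    (B : nat -> {poly R}) :
  (@lebesgue_measure R).-integrable `[l, r] (EFin \o f) ->
  moment l r f (\sum_(i < m) a i *: B i) = \sum_(i < m) a i * moment l r f (B i).
Proof.
move=> fi; elim: m => [|m IH].
  by rewrite !big_ord0; apply: Rintegral_eq0 => y _; rewrite horner0 mulr0.
rewrite !big_ord_recr /= -IH /moment -RintegralZl//; last exact: integrable_mul_horner.
rewrite -RintegralD//.
- by apply: eq_Rintegral => y _; rewrite hornerD hornerZ mulrDr mulrCA.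
- exact: integrable_mul_horner.
- have := integrable_mul_horner (a m *: B m) fi.
  by apply: eq_integrable => // y _; rewrite /= hornerZ mulrCA.
Qed.

Lemma momentB (R : realType) (l r : R) (f g : R -> R) (v : {poly R}) :
  (@lebesgue_measure R).-integrable `[l, r] (EFin \o f) ->
  (@lebesgue_measure R).-integrable `[l, r] (EFin \o g) ->
  moment l r (fun y => f y - g y) v = moment l r f v - moment l r g v.
Proof.
move=> fi gi; rewrite /moment -RintegralB//; [|exact: integrable_mul_horner..].
by apply: eq_Rintegral => y _; rewrite mulrBl.
Qed.

Lemma moment_ext (R : realType) (l r : R) (f g : R -> R) (m : nat) : l < r ->
  (@lebesgue_measure R).-integrable `[l, r] (EFin \o f) ->
  (@lebesgue_measure R).-integrable `[l, r] (EFin \o g) ->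
  (forall n, (n < m)%N ->
     moment l r f (cell_basis l r n) = moment l r g (cell_basis l r n)) ->
  forall v : {poly R}, (size v <= m)%N -> moment l r f v = moment l r g v.
Proof.
move=> lr fi gi fg v vm; have [c ->] := cell_basis_span lr vm.
by rewrite !moment_sum//; apply: eq_bigr => i _; rewrite fg.
Qed.

Lemma integral_comp_cell (R : realType) (l r : R) (p : {poly R}) : l < r ->
  \int[@lebesgue_measure R]_(y in `[l, r])
    (p \Po ((r - l)^-1 *: ('X - l%:P))).[y] = (r - l) * unit_integral p.
Proof.
move=> lr; have h0 : r - l != 0 by rewrite subr_eq0 gt_eqF.
have [P _ dP] := poly_antiderivative p.
rewrite (@Rintegral_horner _ _ _ _ ((r - l) *: (P \Po ((r - l)^-1 *: ('X - l%:P)))));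
  [|exact: ltW|]; last first.
  rewrite derivZ deriv_comp dP derivZ derivXsubC -scalerAr mulr1 scalerA.
  by rewrite divff// scale1r.
rewrite /unit_integral (Rintegral_horner ler01 dP) !hornerZ !horner_comp.
by rewrite !hornerZ !hornerXsubC subrr mulr0 mulVf// mulrBr.
Qed.

Lemma moment_cell_basis (R : realType) (l r : R) (m n : nat) : l < r ->
  moment l r (horner (cell_basis l r m)) (cell_basis l r n) =
  (r - l) * unit_integral (legendre R m * legendre R n).
Proof.
move=> lr; rewrite -integral_comp_cell//; apply: eq_Rintegral => y _.
by rewrite !horner_comp hornerM.
Qed.

Lemma moment_comb (R : realType) (l r : R) (m n : nat) (c : nat -> R) : l < r ->
  (n < m)%N ->
  moment l r (horner (\sum_(i < m) c i *: cell_basis l r i)) (cell_basis l r n) =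
  c n * ((r - l) * unit_integral (legendre R n ^+ 2)).
Proof.
move=> lr nm.
transitivity (moment l r (horner (cell_basis l r n))
    (\sum_(i < m) c i *: cell_basis l r i)).
  by apply: eq_Rintegral => y _; rewrite mulrC.
rewrite moment_sum; last by apply: integrable_contT; exact: continuous_horner.
rewrite (bigD1 (Ordinal nm))//= moment_cell_basis// -expr2 big1 ?addr0// => i ni.
by rewrite moment_cell_basis// legendre_orthogonal ?mulr0// eq_sym.
Qed.

Lemma legendre_bound (R : realType) (n : nat) :
  exists2 B, 0 <= B & forall t, 0 <= t <= 1 -> `|(legendre R n).[t]| <= B.
Proof.
have [B B0 HB] := horner_bound (legendre R n) ler01.
by exists B => // t /andP[t0 t1]; apply: HB; rewrite ger0_norm.
Qed.

Lemma cell_coordinate (R : realType) (l r y : R) : l < r -> l <= y <= r ->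
  0 <= (y - l) / (r - l) <= 1.
Proof.
move=> lr /andP[ly yr]; have h0 : 0 < r - l by rewrite subr_gt0.
apply/andP; split; first by rewrite divr_ge0 ?subr_ge0// ltW.
by rewrite ler_pdivrMr// mul1r lerB.
Qed.

Lemma moment_bound (R : realType) (l r Z B : R) (f : R -> R) (v : {poly R}) : l < r ->
  (@lebesgue_measure R).-integrable `[l, r] (EFin \o f) ->
  (forall y, l <= y <= r -> `|f y| <= Z) ->
  (forall y, l <= y <= r -> `|v.[y]| <= B) ->
  `|moment l r f v| <= Z * B * (r - l).
Proof.
move=> lr fi fZ vB; apply: le_norm_Rintegral_ae => //; first exact: ltW.
- exact: integrable_mul_horner.
- have lrr : l <= l <= r by rewrite lexx ltW.
  by rewrite mulr_ge0// ?(le_trans _ (fZ _ lrr))// (le_trans _ (vB _ lrr)).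
- apply: aeW => y /=; rewrite in_itv/= => ylr; rewrite normrM.
  by apply: ler_pM => //; [exact: fZ|exact: vB].
Qed.

(* [Ul0], [Ul1] and [Ur0], [Ur1] are the prescribed values of u, u_x at [l] and [r]. *)
Definition cell_problem (R : realType) (k : nat) (l r al b1 b2 : R) (u : R -> R)
    (Ul0 Ul1 Ur0 Ur1 : R) (q : {poly R}) : Prop :=
  [/\ (size q <= k.+1)%N,
      forall v : {poly R}, (size v <= k.-1)%N ->
        moment l r (horner q) v = moment l r u v,
      left_conditions al b1 b2 (q.[l] - Ul0) (q^`().[l] - Ul1) &
      right_conditions al b1 b2 (q.[r] - Ur0) (q^`().[r] - Ur1)].

Definition cell_Gamma (R : realType) (k : nat) (h b1 b2 : R) : R :=
  b1 - k%:R ^+ 2 / h + b2 * (k%:R ^+ 2 * (k%:R ^+ 2 - 1) / h ^+ 2).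

Definition cell_comb (R : realType) (m : nat) (l r : R) (c : nat -> R) : {poly R} :=
  \sum_(i < m) c i *: cell_basis l r i.

Lemma cell_combS (R : realType) (m : nat) (l r : R) (c : nat -> R) :
  cell_comb m.+1 l r c = cell_comb m l r c + c m *: cell_basis l r m.
Proof. exact: big_ord_recr. Qed.

(** With k = [p.+1], the moments fix the k - 1 = p coefficients of [q0]; its end values join the
    data, and only the coefficients of index p and [p.+1] remain unknown. *)
Lemma cell_comb_solve (R : realType) (p : nat) (l r al b1 b2 : R)
    (Ul0 Ul1 Ur0 Ur1 : R) (c : nat -> R) :
  let q := cell_comb p.+2 l r c in let q0 := cell_comb p l r c in
  let h := r - l in let s := (-1) ^+ p.+1 in
  let K := p.+1%:R * p.+2%:R / h in let K' := p%:R * p.+1%:R / h in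
  let r0 := Ur0 - q0.[r] in let r1 := Ur1 - q0^`().[r] in
  let l0 := Ul0 - q0.[l] in let l1 := Ul1 - q0^`().[l] in
  let G := cell_Gamma p.+1 h b1 b2 in
  l < r -> al ^+ 2 + b1 * b2 = 4^-1 -> b1 != 0 \/ b2 != 0 -> G != 0 ->
  (right_conditions al b1 b2 (q.[r] - Ur0) (q^`().[r] - Ur1) /\
   left_conditions al b1 b2 (q.[l] - Ul0) (q^`().[l] - Ul1)) <->
  (2 * G * c p =
     (b1 * r0 - (2^-1 - al) * r1 - (2^-1 + al) * K * r0 + b2 * K * r1)
   + - s * (b1 * l0 + (2^-1 + al) * l1 - (2^-1 - al) * K * l0 - b2 * K * l1) /\
   2 * G * c p.+1 =
     (b1 * r0 - (2^-1 - al) * r1 - (2^-1 + al) * K' * r0 + b2 * K' * r1)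
   + s * (b1 * l0 + (2^-1 + al) * l1 - (2^-1 - al) * K' * l0 - b2 * K' * l1)).
Proof.
move=> q q0 h s K K' r0 r1 l0 l1 G lr H b12 G0.
have h0 : h != 0 by rewrite subr_eq0 gt_eqF.
have s2 : s ^+ 2 = 1 by rewrite sqrr_sign.
(* From K = k (k + 1) / h and K' = k (k - 1) / h: their mean is k^2 / h and their product k^2 (k^2 -
   1) / h^2, the two terms of Gamma_j. *)
have GE : G = b1 - (K + K') / 2 + b2 * (K * K').
  rewrite /G /cell_Gamma /K /K' -[p.+2%:R]natr1 -[p.+1%:R]natr1.
  by field.
rewrite GE in G0 *; rewrite (mulNr s).
rewrite -(pstar_solve r0 r1 l0 l1 (c p) (c p.+1) H b12 s2 G0).
have qr : q.[r] - Ur0 = c p + c p.+1 - r0.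
  by rewrite /q !cell_combS !hornerD !hornerZ !cell_basis_right// /r0; ring.
have qr' : q^`().[r] - Ur1 = c p * K' + c p.+1 * K - r1.
  rewrite /q !cell_combS !derivD !derivZ !hornerD !hornerZ.
  by rewrite !deriv_cell_basis_right// /r1 /K /K'; ring.
have ql : q.[l] - Ul0 = s * (c p.+1 - c p) - l0.
  rewrite /q !cell_combS !hornerD !hornerZ !cell_basis_left /l0 /s exprS.
  by rewrite -/q0; ring.
have ql' : q^`().[l] - Ul1 = s * (c p * K' - c p.+1 * K) - l1.
  rewrite /q !cell_combS !derivD !derivZ !hornerD !hornerZ.
  by rewrite !deriv_cell_basis_left /l1 /K /K' /s exprS -/h -/q0; ring.
by rewrite qr qr' ql ql'.
Qed.

Lemma unit_integral_legendre_gt0 (R : realType) (n : nat) :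
  0 < unit_integral (legendre R n ^+ 2).
Proof. by apply: unit_integral_sqr_gt0; exact: legendre_neq0. Qed.

Lemma size_cell_comb (R : realType) (m : nat) (l r : R) (c : nat -> R) : l < r ->
  (size (cell_comb m l r c) <= m)%N.
Proof.
move=> lr; elim: m => [|m IH]; first by rewrite /cell_comb big_ord0 size_poly0.
rewrite cell_combS (leq_trans (size_polyD _ _))// geq_max (leq_trans IH)//=.
by rewrite (leq_trans (size_scale_leq _ _))// size_cell_basis.
Qed.

Lemma cell_problem_exists (R : realType) (k : nat) (l r al b1 b2 : R) (u : R -> R)
    (Ul0 Ul1 Ur0 Ur1 : R) : (0 < k)%N -> l < r ->
  al ^+ 2 + b1 * b2 = 4^-1 -> b1 != 0 \/ b2 != 0 ->
  cell_Gamma k (r - l) b1 b2 != 0 ->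
  (@lebesgue_measure R).-integrable `[l, r] (EFin \o u) ->
  exists q, cell_problem k l r al b1 b2 u Ul0 Ul1 Ur0 Ur1 q.
Proof.
case: k => // p _ lr H b12 G0 ui; set h := r - l in G0; set G := cell_Gamma _ _ _ _ in G0.
have h0 : h != 0 by rewrite subr_eq0 gt_eqF.
pose J n := unit_integral (legendre R n ^+ 2).
have J0 n : J n != 0 by rewrite gt_eqF// unit_integral_legendre_gt0.
(* Fourier-Legendre coefficients of u: [h * J n] is the squared L^2 norm of the n-th basis
   function. *)
pose c0 n := moment l r u (cell_basis l r n) / (h * J n).
pose q0 := cell_comb p l r c0.
pose s : R := (-1) ^+ p.+1.
pose K : R := p.+1%:R * p.+2%:R / h; pose K' : R := p%:R * p.+1%:R / h.
pose r0 := Ur0 - q0.[r]; pose r1 := Ur1 - q0^`().[r].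
pose l0 := Ul0 - q0.[l]; pose l1 := Ul1 - q0^`().[l].
pose NA := (b1 * r0 - (2^-1 - al) * r1 - (2^-1 + al) * K * r0 + b2 * K * r1)
   + - s * (b1 * l0 + (2^-1 + al) * l1 - (2^-1 - al) * K * l0 - b2 * K * l1).
pose NB := (b1 * r0 - (2^-1 - al) * r1 - (2^-1 + al) * K' * r0 + b2 * K' * r1)
   + s * (b1 * l0 + (2^-1 + al) * l1 - (2^-1 - al) * K' * l0 - b2 * K' * l1).
pose c n := if (n < p)%N then c0 n else if n == p then NA / (2 * G) else NB / (2 * G).
have q0E : cell_comb p l r c = q0 by apply: eq_bigr => i _; rewrite /c ltn_ord.
have cp : c p = NA / (2 * G) by rewrite /c ltnn eqxx.
have cp1 : c p.+1 = NB / (2 * G) by rewrite /c ltnNge leqnSn /= gtn_eqF.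
have G20 : 2 * G != 0 by rewrite mulf_neq0// pnatr_eq0.
have [|rc lc] := (cell_comb_solve Ul0 Ul1 Ur0 Ur1 c lr H b12 G0).2.
  by rewrite -/h -/G cp cp1 q0E; split; rewrite [LHS]mulrC divfK.
exists (cell_comb p.+2 l r c); split=> //; first exact: size_cell_comb.
move=> v vp; apply: (moment_ext lr _ ui _ vp).
  by apply: integrable_contT; exact: continuous_horner.
move=> n np; rewrite moment_comb//; last exact: leq_trans np (leqW (leqnSn _)).
by rewrite /c np /c0 divfK// mulf_neq0.
Qed.

Lemma cell_coef_bound (R : realType) (k : nat) : (0 < k)%N ->
  exists2 C : R, 0 <= C & forall (l r al b1 b2 : R) (Ul0 Ul1 Ur0 Ur1 : R)
    (c : nat -> R) (Z W : R), l < r ->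
  let h := r - l in let G := cell_Gamma k h b1 b2 in
  let q := cell_comb k.+1 l r c in
  al ^+ 2 + b1 * b2 = 4^-1 -> b1 != 0 \/ b2 != 0 -> G != 0 ->
  left_conditions al b1 b2 (q.[l] - Ul0) (q^`().[l] - Ul1) ->
  right_conditions al b1 b2 (q.[r] - Ur0) (q^`().[r] - Ur1) ->
  (forall n, (n < k.-1)%N -> `|c n| <= Z) ->
  `|Ul0| <= Z -> `|Ul1| <= Z / h -> `|Ur0| <= Z -> `|Ur1| <= Z / h ->
  `|b1| <= W -> Num.min (`|2^-1 - al| / h) (`|2^-1 + al| / h) <= W ->
  `|b2| / h ^+ 2 <= W ->
  forall n, (n < k.+1)%N -> `|c n| <= C * Z * (1 + W / `|G|).
Proof.
case: k => // p _.
(* Bounds the data once the first p modes are moved to the right: 1 for the datum itself, and for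
   mode i an end value of modulus 1 and a slope of modulus i (i + 1) / h. *)
pose D : R := 1 + \sum_(i < p) (1 + i%:R * i.+1%:R).
pose kap : R := p.+1%:R * (p.+1%:R + 1).
have D1 : 1 <= D.
  by rewrite lerDl sumr_ge0// => i _; rewrite addr_ge0// mulr_ge0.
have kap0 : 0 <= kap by rewrite mulr_ge0// addr_ge0.
have C1 : 1 <= (1 + kap) * (5 + p.+1%:R ^+ 4) :> R.
  have q40 : 0 <= (p.+1%:R : R) ^+ 4 by rewrite exprn_ge0.
  have := mulr_ge0 kap0 q40; rewrite mulrDl !mulrDr mul1r mulr1; lra.
have C0 := le_trans ler01 C1; have D0 := le_trans ler01 D1.
exists ((1 + kap) * (5 + p.+1%:R ^+ 4) * D); first by rewrite mulr_ge0.
move=> l r al b1 b2 Ul0 Ul1 Ur0 Ur1 c Z W lr h G q H b12 G0 lc rc cZ.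
move=> Ul0Z Ul1Z Ur0Z Ur1Z b1W cdW b2W.
have h0 : 0 < h by rewrite subr_gt0.
have Z0 : 0 <= Z by exact: le_trans Ul0Z.
have W0 : 0 <= W by exact: le_trans b1W.
have [Ep Ep1] := (cell_comb_solve Ul0 Ul1 Ur0 Ur1 c lr H b12 G0).1 (conj rc lc).
(* Used four times: with e = 1 for the values and e = 1 / h for the derivatives, at both ends. *)
have base (U e : R) (P : nat -> R) (f : {poly R} -> R) : 0 < e ->
    (f (cell_comb p l r c) = \sum_(i < p) c i * P i) ->
    (forall i, `|P i| <= (1 + i%:R * i.+1%:R) * e) -> `|U| <= Z * e ->
    `|U - f (cell_comb p l r c)| <= D * Z * e.
  move=> e0 fE PB UZ; rewrite (le_trans (ler_normB _ _))//.
  rewrite /D -mulrA mulrDl mul1r; apply: lerD => //.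
  rewrite fE (le_trans (ler_norm_sum _ _ _))// !mulr_suml.
  apply: ler_sum => i _; rewrite normrM mulrCA.
  by rewrite ler_pM// cZ.
have ii0 (i : nat) : 0 <= i%:R * i.+1%:R :> R by rewrite mulr_ge0.
have hi0 : 0 < h^-1 by rewrite invr_gt0.
have DZ0 : 0 <= D * Z by rewrite mulr_ge0.
have combE (x : R) : (cell_comb p l r c).[x] = \sum_(i < p) c i * (cell_basis l r i).[x].
  by rewrite horner_sum; apply: eq_bigr => i _; rewrite hornerZ.
have combE' (x : R) : (cell_comb p l r c)^`().[x] =
    \sum_(i < p) c i * (cell_basis l r i)^`().[x].
  by rewrite linear_sum horner_sum; apply: eq_bigr => i _; rewrite linearZ hornerZ.
have r0Z : `|Ur0 - (cell_comb p l r c).[r]| <= D * Z.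
  rewrite -[leRHS]mulr1; apply: (base _ _ (fun i => (cell_basis l r i).[r]) (fun q => q.[r]) _ (combE r)) => //.
    by move=> i /=; rewrite cell_basis_right// normr1 mulr1 lerDl.
  by rewrite mulr1.
have l0Z : `|Ul0 - (cell_comb p l r c).[l]| <= D * Z.
  rewrite -[leRHS]mulr1; apply: (base _ _ (fun i => (cell_basis l r i).[l]) (fun q => q.[l]) _ (combE l)) => //.
    by move=> i /=; rewrite cell_basis_left normrX normrN1 expr1n mulr1 lerDl.
  by rewrite mulr1.
have r1Z : `|Ur1 - (cell_comb p l r c)^`().[r]| <= D * Z / h.
  apply: (base _ _ (fun i => (cell_basis l r i)^`().[r]) (fun q => q^`().[r]) _ (combE' r)) => //= i.
  rewrite deriv_cell_basis_right// ger0_norm; last by rewrite mulr_ge0// ltW.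
  by rewrite ler_wpM2r ?lerDr// ltW.
have l1Z : `|Ul1 - (cell_comb p l r c)^`().[l]| <= D * Z / h.
  apply: (base _ _ (fun i => (cell_basis l r i)^`().[l]) (fun q => q^`().[l]) _ (combE' l)) => //= i.
  rewrite deriv_cell_basis_left normrM normrN normrX normrN1 expr1n mul1r.
  rewrite ger0_norm; last by rewrite mulr_ge0// ltW.
  by rewrite ler_wpM2r ?lerDr// ltW.
have q1 : 1 <= p.+1%:R :> R by rewrite ler1n.
have K0 : 0 <= p.+1%:R * p.+2%:R / h by rewrite mulr_ge0// ltW.
have K'0 : 0 <= p%:R * p.+1%:R / h by rewrite mulr_ge0// ltW.
have Kk : p.+1%:R * p.+2%:R / h <= kap / h by rewrite /kap natr1.
have K'k : p%:R * p.+1%:R / h <= kap / h.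
  by rewrite ler_wpM2r ?(ltW hi0)// /kap natr1 mulrC ler_wpM2l// ler_nat leqW.
have s1 : `|(-1) ^+ p.+1| = 1 :> R by rewrite normrX normrN1 expr1n.
have s1' : `|- (-1) ^+ p.+1| = 1 :> R by rewrite normrN.
have Cp1 : `|c p.+1| <= (1 + kap) * (5 + p.+1%:R ^+ 4) * (D * Z) * (1 + W / `|G|).
  exact: (solution_bound (al := al) h0 q1 G0 K'0 K'k s1 r0Z r1Z l0Z l1Z b1W cdW b2W Ep1).
have Cp : `|c p| <= (1 + kap) * (5 + p.+1%:R ^+ 4) * (D * Z) * (1 + W / `|G|).
  exact: (solution_bound (al := al) h0 q1 G0 K0 Kk s1' r0Z r1Z l0Z l1Z b1W cdW b2W Ep).
move=> n; rewrite ltnS leq_eqVlt => /predU1P[->|]; first by rewrite -[_ * D * Z]mulrA.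
rewrite ltnS leq_eqVlt => /predU1P[->|np]; first by rewrite -[_ * D * Z]mulrA.
apply: (le_trans (cZ _ np)); rewrite mulrAC -[leLHS]mul1r ler_wpM2r//.
have w1 : 1 <= 1 + W / `|G| by rewrite lerDl divr_ge0.
by rewrite -[leLHS]mulr1 ler_pM// -[leLHS]mulr1 ler_pM.
Qed.

Lemma legendre_bounds (R : realType) : exists B : nat -> R, forall n, 0 <= B n /\
  forall l r y : R, l < r -> l <= y <= r -> `|(cell_basis l r n).[y]| <= B n.
Proof.
have /choice[B HB] : forall n, exists B : R, 0 <= B /\
    forall t, 0 <= t <= 1 -> `|(legendre R n).[t]| <= B.
  by move=> n; have [B B0 HB] := legendre_bound R n; exists B.
exists B => n; have [B0 Bn] := HB n; split=> // l r y lr ylr.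
by rewrite horner_cell_basis; apply: Bn; exact: cell_coordinate.
Qed.

(** The difference q - T solves the cell problem with data u - T: its low coefficients are moments
    of u - T divided by the norms of the basis functions, and the last two follow from the interface
    conditions. The end data need not be values of u. *)
Lemma cell_error (R : realType) (k : nat) : (0 < k)%N ->
  exists2 C : R, 0 <= C & forall (l r al b1 b2 : R) (u : R -> R)
    (Ul0 Ul1 Ur0 Ur1 : R) (q T : {poly R}) (Z W : R), l < r ->
  let h := r - l in let G := cell_Gamma k h b1 b2 in
  al ^+ 2 + b1 * b2 = 4^-1 -> b1 != 0 \/ b2 != 0 -> G != 0 ->
  (@lebesgue_measure R).-integrable `[l, r] (EFin \o u) ->
  cell_problem k l r al b1 b2 u Ul0 Ul1 Ur0 Ur1 q -> (size T <= k.+1)%N ->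
  (forall y, l <= y <= r -> `|u y - T.[y]| <= Z) ->
  `|Ul0 - T.[l]| <= Z -> `|Ul1 - T^`().[l]| <= Z / h ->
  `|Ur0 - T.[r]| <= Z -> `|Ur1 - T^`().[r]| <= Z / h ->
  `|b1| <= W -> Num.min (`|2^-1 - al| / h) (`|2^-1 + al| / h) <= W ->
  `|b2| / h ^+ 2 <= W ->
  forall y, l <= y <= r -> `|q.[y] - T.[y]| <= C * Z * (1 + W / `|G|).
Proof.
move=> k0; have [C C0 HC] := cell_coef_bound R k0.
have [B HB] := legendre_bounds R.
pose J n := unit_integral (legendre R n ^+ 2).
have J0 n : 0 < J n := unit_integral_legendre_gt0 R n.
(* The sum bounds each low coefficient, at most (B n / J n) Z; the summand 1 lets E Z also bound the
   end data. *)
pose E : R := 1 + \sum_(i < k) B i / J i.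
have BJ0 i : 0 <= B i / J i by rewrite divr_ge0 ?(HB i).1// ltW.
have E1 : 1 <= E by rewrite lerDl sumr_ge0.
have E0 := le_trans ler01 E1.
exists (\sum_(i < k.+1) C * E * B i).
  by apply: sumr_ge0 => i _; rewrite mulr_ge0 ?(HB i).1// mulr_ge0.
move=> l r al b1 b2 u Ul0 Ul1 Ur0 Ur1 q T Z W lr h G H b12 G0 ui [sq qm lc rc] sT uT.
move=> Ul0Z Ul1Z Ur0Z Ur1Z b1W cdW b2W y ylr.
have Z0 : 0 <= Z by exact: le_trans Ul0Z.
have h0 : 0 < h by rewrite subr_gt0.
have sqT : (size (q - T)%R <= k.+1)%N.
  by rewrite (leq_trans (size_polyD _ _))// size_polyN geq_max sq.
have [c qTc] := cell_basis_span lr sqT.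
have iT (p : {poly R}) : (@lebesgue_measure R).-integrable `[l, r] (EFin \o horner p).
  by apply: integrable_contT; exact: continuous_horner.
have ck n : (n < k.-1)%N -> `|c n| <= E * Z.
  move=> nk; have nk' : (n < k)%N by exact: leq_trans nk (leq_pred _).
  have mE : c n * (h * J n) = moment l r (fun y => u y - T.[y]) (cell_basis l r n).
    rewrite momentB// -qm; last exact: leq_trans (size_cell_basis _ lr) _.
    rewrite -momentB// -(@moment_comb _ l r k.+1)//; last exact: ltnW.
    by rewrite -qTc; apply: eq_Rintegral => z _; rewrite hornerD hornerN.
  have mB := moment_bound (f := fun y => u y - T.[y]) lr _ uT
    (fun z => (HB n).2 l r z lr).
  have hJ0 : 0 < h * J n by rewrite mulr_gt0.
  rewrite -(ler_pM2r hJ0) -[X in _ * X <= _](gtr0_norm hJ0) -normrM mE.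
  rewrite (le_trans (mB _))//; first exact: integrable_fun_sub.
  have -> : Z * B n * (r - l) = B n / J n * (Z * (h * J n)).
    by rewrite /h; field; rewrite gt_eqF.
  rewrite -[leRHS]mulrA; apply: ler_wpM2r; first by rewrite mulr_ge0// ltW.
  by rewrite /E (bigD1 (Ordinal nk'))//= addrCA lerDl addr_ge0// sumr_ge0.
have EZ : Z <= E * Z by rewrite ler_peMl.
have EZh : Z / h <= E * Z / h by rewrite ler_wpM2r// invr_ge0 ltW.
have key := HC l r al b1 b2 (Ul0 - T.[l]) (Ul1 - T^`().[l]) (Ur0 - T.[r])
  (Ur1 - T^`().[r]) c (E * Z) W lr H b12 G0.
have cE : cell_comb k.+1 l r c = q - T by [].
have {}key : forall n, (n < k.+1)%N -> `|c n| <= C * (E * Z) * (1 + W / `|G|).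
  apply: key => //; rewrite ?cE ?derivB ?hornerD ?hornerN ?opprB ?addrA ?subrK //;
  exact: le_trans EZ || exact: le_trans EZh.
have -> : q.[y] - T.[y] = (cell_comb k.+1 l r c).[y] by rewrite cE hornerD hornerN.
rewrite horner_sum (le_trans (ler_norm_sum _ _ _))// !mulr_suml.
apply: ler_sum => i _; rewrite hornerZ normrM.
have -> : C * E * B i * Z * (1 + W / `|G|) = (C * (E * Z) * (1 + W / `|G|)) * B i by ring.
by apply: ler_pM => //; [exact: key|exact: (HB i).2].
Qed.

(** The error estimate with q2 both as function and as comparison polynomial, so that Z = 0: any W
    above the three parameter quantities will do. *)
Lemma cell_problem_unique (R : realType) (k : nat) (l r al b1 b2 : R) (u : R -> R)
    (Ul0 Ul1 Ur0 Ur1 : R) (q1 q2 : {poly R}) : (0 < k)%N -> l < r ->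
  al ^+ 2 + b1 * b2 = 4^-1 -> b1 != 0 \/ b2 != 0 ->
  cell_Gamma k (r - l) b1 b2 != 0 ->
  cell_problem k l r al b1 b2 u Ul0 Ul1 Ur0 Ur1 q1 ->
  cell_problem k l r al b1 b2 u Ul0 Ul1 Ur0 Ur1 q2 ->
  forall y, l <= y <= r -> q1.[y] = q2.[y].
Proof.
move=> k0 lr H b12 G0 [s1 m1 [l1 l1'] [r1 r1']] [s2 m2 [l2 l2'] [r2 r2']].
have [C C0 HC] := cell_error R k0 => y ylr.
have P1 : cell_problem k l r al b1 b2 (horner q2) q2.[l] q2^`().[l] q2.[r] q2^`().[r] q1.
  split=> //; first by move=> v vk; rewrite m1// m2.
  - by split; lra.
  - by split; lra.
pose W := Num.max `|b1| (Num.max (`|2^-1 - al| / (r - l)) (`|b2| / (r - l) ^+ 2)).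
have i2 : (@lebesgue_measure R).-integrable `[l, r] (EFin \o horner q2).
  by apply: integrable_contT; exact: continuous_horner.
have := HC l r al b1 b2 _ _ _ _ _ q1 q2 0 W lr H b12 G0 i2 P1 s2.
rewrite !subrr !normr0 mul0r lexx mulr0 mul0r => /(_ _ isT isT isT isT).
move=> key; apply/eqP; rewrite -subr_eq0 -normr_le0; apply: key => //.
- by move=> z _; rewrite subrr normr0.
- by rewrite le_max lexx.
- by rewrite ge_min !le_max lexx !orbT.
- by rewrite !le_max lexx !orbT.
Qed.

(** * From the mesh to the cells *)

Lemma lim_left_poly (R : realType) (l r : R) (f : R -> R) (q : {poly R}) : l < r ->
  (forall y, l < y < r -> f y = q.[y]) -> lim (f y @[y --> r^'-]) = q.[r].
Proof.
move=> lr fq; apply/cvg_lim => //.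
have : q.[y] @[y --> r^'-] --> q.[r].
  by apply: cvg_at_left_filter; exact: continuous_horner.
apply: cvg_trans; apply: near_eq_cvg; near=> y; rewrite fq//.
by apply/andP; split; near: y; [exact: nbhs_left_gt|exact: nbhs_left_lt].
Unshelve. all: by end_near. Qed.

Lemma lim_right_poly (R : realType) (l r : R) (f : R -> R) (q : {poly R}) : l < r ->
  (forall y, l < y < r -> f y = q.[y]) -> lim (f y @[y --> l^'+]) = q.[l].
Proof.
move=> lr fq; apply/cvg_lim => //.
have : q.[y] @[y --> l^'+] --> q.[l].
  by apply: cvg_at_right_filter; exact: continuous_horner.
apply: cvg_trans; apply: near_eq_cvg; near=> y; rewrite fq//.
by apply/andP; split; near: y; [exact: nbhs_right_gt|exact: nbhs_right_lt].
Unshelve. all: by end_near. Qed.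

Lemma derive1_eq_poly (R : realType) (l r : R) (f : R -> R) (q : {poly R}) :
  (forall y, l < y < r -> f y = q.[y]) ->
  forall y, l < y < r -> derive1 f y = q^`().[y].
Proof.
move=> fq y /andP[ly yr]; have [_ <-] := is_derive_poly q y.
rewrite derive1E; apply: near_eq_derive; near=> z; apply: fq.
by apply/andP; split; near: z; [exact: lt_nbhsr|exact: lt_nbhsl].
Unshelve. all: by end_near. Qed.

Lemma derive1_periodic (R : realType) (u : R -> R) (T : R) : periodic u T ->
  forall y, derive1 u (y + T) = derive1 u y.
Proof.
move=> uT y; rewrite /derive1 uT.
suff -> : (fun h => h^-1 *: (u (h + (y + T)) - u y)) =
  (fun h => h^-1 *: (u (h + y) - u y)) by [].
by apply/funext => h; rewrite addrA uT.
Qed.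

Lemma mesh_le (R : realType) (a b : R) (N : nat) (x : nat -> R) (i j : nat) :
  is_mesh a b N x -> (i <= j)%N -> (j <= N)%N -> x i <= x j.
Proof.
move=> [_ _ xlt]; elim: j => [|j IH] ij jN; first by move: ij; rewrite leqn0 => /eqP->.
move: ij; rewrite leq_eqVlt => /predU1P[->//|]; rewrite ltnS => ij.
by rewrite (le_trans (IH ij (ltnW jN)))// ltW// xlt.
Qed.

Lemma mesh_gt0 (R : realType) (a b : R) (N : nat) (x : nat -> R) :
  a < b -> is_mesh a b N x -> (0 < N)%N.
Proof. by move=> ab [x0 xN _]; case: N xN => // xN; move: ab; rewrite -x0 -xN ltxx. Qed.

Lemma mesh_periodic (R : realType) (a b : R) (N : nat) (x : nat -> R) (v : R -> R)
    (j : nat) : is_mesh a b N x -> (forall y, v (y + (b - a)) = v y) -> (j < N)%N ->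
  v (x (j.+1 %% N)%N) = v (x j.+1).
Proof.
move=> [x0 xN _] vT; rewrite leq_eqVlt => /predU1P[jN|jN]; last by rewrite modn_small.
by rewrite jN modnn x0 xN -(vT a) addrC subrK.
Qed.

Lemma mesh_prev (N i : nat) : (i < N)%N -> exists2 j, (j < N)%N & (j.+1 %% N)%N = i.
Proof.
case: i => [|i] iN; last by exists i; rewrite ?modn_small// ltnW.
by exists N.-1; rewrite prednK// modnn.
Qed.

Lemma mesh_integrable (R : realType) (a b : R) (N : nat) (x : nat -> R) (u : R -> R)
    (j : nat) : is_mesh a b N x ->
  (@lebesgue_measure R).-integrable `[a, b] (EFin \o u) -> (j < N)%N ->
  (@lebesgue_measure R).-integrable `[x j, x j.+1] (EFin \o u).
Proof.
move=> mx ui jN; have [x0 xN _] := mx; apply: (integrable_sub_itv ui).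
apply: subset_itv; rewrite bnd_simp.
  by rewrite -x0 (mesh_le mx)// ltnW.
by rewrite -xN (mesh_le mx).
Qed.

Definition mesh_problem (R : realType) (k : nat) (x : nat -> R) (al b1 b2 : R)
    (u : R -> R) (j : nat) (q : {poly R}) : Prop :=
  cell_problem k (x j) (x j.+1) al b1 b2 u (u (x j)) (derive1 u (x j))
    (u (x j.+1)) (derive1 u (x j.+1)) q.

Lemma cell_moment (R : realType) (l r : R) (f : R -> R) (v : {poly R}) :
  (@lebesgue_measure R).-integrable `[l, r] (EFin \o f) ->
  \int[@lebesgue_measure R]_(y in `]l, r[) (f y * v.[y]) = moment l r f v.
Proof.
move=> fi; apply: Rintegral_oo_cc; apply: (integrable_sub_itv (integrable_mul_horner v fi)).
by apply: subset_itv; rewrite bnd_simp.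
Qed.

(** One-sided limits of w and w_x are end values of the pieces and of their derivatives. Each
    interface then contributes the right conditions of its left cell and the left conditions of its
    right cell; periodicity of u and u_x identifies the data at a and b. *)
Lemma is_PstarE (R : realType) (a b : R) (k N : nat) (x : nat -> R) (al b1 b2 : R)
    (u w : R -> R) (q : nat -> {poly R}) :
  is_mesh a b N x -> periodic u (b - a) ->
  (@lebesgue_measure R).-integrable `[a, b] (EFin \o u) ->
  al ^+ 2 + b1 * b2 = 4^-1 ->
  (forall j, (j < N)%N -> (size (q j) <= k.+1)%N /\
     forall y, cell x j y -> w y = (q j).[y]) ->
  is_Pstar k N x al b1 b2 u w <->
  forall j, (j < N)%N -> mesh_problem k x al b1 b2 u j (q j).
Proof.
move=> mx uT ui H wq; have [x0 xN xlt] := mx.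
have wq' j y : (j < N)%N -> x j < y < x j.+1 -> w y = (q j).[y].
  by move=> jN yj; apply: (wq j jN).2; rewrite /cell /= in_itv.
have modN j : (j < N)%N -> (j.+1 %% N < N)%N by move=> jN; rewrite ltn_mod (leq_ltn_trans _ jN).
have L0 j : (j < N)%N -> left_limit x w j = (q j).[x j.+1].
  by move=> jN; apply: (lim_left_poly (xlt _ jN)) => y; exact: wq'.
have L1 j : (j < N)%N -> left_limit x (derive1 w) j = (q j)^`().[x j.+1].
  move=> jN; apply: (lim_left_poly (xlt _ jN)).
  by apply: derive1_eq_poly => y; exact: wq'.
have R0 j : (j < N)%N ->
    right_limit N x w j = (q (j.+1 %% N)%N).[x (j.+1 %% N)%N].
  by move=> /modN jN; apply: (lim_right_poly (xlt _ jN)) => y; exact: wq'.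
have R1 j : (j < N)%N ->
    right_limit N x (derive1 w) j = (q (j.+1 %% N)%N)^`().[x (j.+1 %% N)%N].
  move=> /modN jN; apply: (lim_right_poly (xlt _ jN)).
  by apply: derive1_eq_poly => y; exact: wq'.
have mom j (v : {poly R}) : (j < N)%N ->
    \int[@lebesgue_measure R]_(y in cell x j) (w y * v.[y]) =
      moment (x j) (x j.+1) (horner (q j)) v.
  move=> jN; rewrite -cell_moment; last by apply: integrable_contT; exact: continuous_horner.
  by apply: eq_Rintegral => y /set_mem yj; rewrite (wq j jN).2.
have momu j (v : {poly R}) : (j < N)%N ->
    \int[@lebesgue_measure R]_(y in cell x j) (u y * v.[y]) =
      moment (x j) (x j.+1) u v.
  by move=> jN; apply: cell_moment; exact: mesh_integrable mx ui jN.
have iface j : (j < N)%N ->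
    (average N x w j - al * jump N x w j + b2 * jump N x (derive1 w) j = u (x j.+1) /\
     average N x (derive1 w) j + al * jump N x (derive1 w) j + b1 * jump N x w j
       = derive1 u (x j.+1)) <->
    left_conditions al b1 b2
      ((q (j.+1 %% N)%N).[x (j.+1 %% N)%N] - u (x (j.+1 %% N)%N))
      ((q (j.+1 %% N)%N)^`().[x (j.+1 %% N)%N] - derive1 u (x (j.+1 %% N)%N)) /\
    right_conditions al b1 b2 ((q j).[x j.+1] - u (x j.+1))
      ((q j)^`().[x j.+1] - derive1 u (x j.+1)).
  move=> jN; rewrite (mesh_periodic mx uT jN).
  rewrite (mesh_periodic mx (derive1_periodic uT) jN) -interface_split//.
  by rewrite /average /jump R0// R1// L0// L1.
split=> [[_ Hw] j jN|Hq].
  (* The left conditions of cell j belong to the preceding interface, which is the one at b when j =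
     0. *)
  have [i iN ij] := mesh_prev jN.
  have [m _ _] := Hw _ jN.
  split.
  - exact: (wq j jN).1.
  - by move=> v vk; rewrite -mom// -momu// m.
  - have [_ e1 e2] := Hw _ iN; have [+ _] := (iface _ iN).1 (conj e1 e2).
    by rewrite ij.
  - by have [_ e1 e2] := Hw _ jN; have [_ +] := (iface _ jN).1 (conj e1 e2).
split=> [j jN|j jN]; first by exists (q j); exact: wq.
have [_ m _ rj] := Hq _ jN; have [_ _ lj _] := Hq _ (modN _ jN).
have [e1 e2] := (iface _ jN).2 (conj lj rj).
by split=> // v vk; rewrite mom// momu// m.
Qed.

Lemma Pstar_exists (R : realType) (a b : R) (k N : nat) (x : nat -> R) (al b1 b2 : R)
    (u : R -> R) : (0 < k)%N -> is_mesh a b N x -> periodic u (b - a) ->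
  (@lebesgue_measure R).-integrable `[a, b] (EFin \o u) ->
  al ^+ 2 + b1 * b2 = 4^-1 -> b1 != 0 \/ b2 != 0 ->
  (forall j, (j < N)%N -> Gamma k x b1 b2 j != 0) ->
  exists w, is_Pstar k N x al b1 b2 u w.
Proof.
move=> k0 mx uT ui H b12 G0; have [x0 xN xlt] := mx.
have /choice[q Hq] : forall j, exists q, (j < N)%N -> mesh_problem k x al b1 b2 u j q.
  move=> j; have [jN|] := boolP (j < N)%N; last by exists 0.
  have [q Hq] := cell_problem_exists (u (x j)) (derive1 u (x j)) (u (x j.+1))
    (derive1 u (x j.+1)) k0 (xlt _ jN) H b12 (G0 _ jN) (mesh_integrable mx ui jN).
  by exists q.
(* Cells are disjoint, so at most one term is active; at mesh points w is 0, a harmless value. *)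
pose w y := \sum_(j < N) if x j < y < x j.+1 then (q j).[y] else 0.
exists w; apply/(is_PstarE mx uT ui H (q := q)) => // j jN.
have [sq _ _ _] := Hq j jN; split=> // y; rewrite /cell /= in_itv/= => yj.
rewrite /w (bigD1 (Ordinal jN))//= yj big1 ?addr0// => i ij.
case: ifPn => // /andP[iy yi]; move/andP: yj => [jy yj].
have [ltij|ltji|eij] := ltngtP i j; last by move: ij; rewrite -val_eqE /= eij eqxx.
- have := mesh_le mx ltij (ltnW jN); lra.
- have := mesh_le mx ltji (ltnW (ltn_ord i)); lra.
Qed.

Lemma is_Pstar_cells (R : realType) (a b : R) (k N : nat) (x : nat -> R) (al b1 b2 : R)
    (u w : R -> R) : is_mesh a b N x -> periodic u (b - a) ->
  (@lebesgue_measure R).-integrable `[a, b] (EFin \o u) ->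
  al ^+ 2 + b1 * b2 = 4^-1 -> is_Pstar k N x al b1 b2 u w ->
  forall j, (j < N)%N -> exists2 q, mesh_problem k x al b1 b2 u j q &
    forall y, cell x j y -> w y = q.[y].
Proof.
move=> mx uT ui H Hw; have [Vw _] := Hw.
have /choice[q Hq] : forall j, exists q : {poly R}, (j < N)%N ->
    (size q <= k.+1)%N /\ forall y, cell x j y -> w y = q.[y].
  move=> j; have [jN|] := boolP (j < N)%N; last by exists 0.
  by have [q Hq] := Vw _ jN; exists q.
move=> j jN; exists (q j); last exact: (Hq _ jN).2.
exact: (is_PstarE mx uT ui H Hq).1.
Qed.

Lemma Pstar_unique (R : realType) (a b : R) (k N : nat) (x : nat -> R) (al b1 b2 : R)
    (u w1 w2 : R -> R) : (0 < k)%N -> is_mesh a b N x -> periodic u (b - a) ->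
  (@lebesgue_measure R).-integrable `[a, b] (EFin \o u) ->
  al ^+ 2 + b1 * b2 = 4^-1 -> b1 != 0 \/ b2 != 0 ->
  (forall j, (j < N)%N -> Gamma k x b1 b2 j != 0) ->
  is_Pstar k N x al b1 b2 u w1 -> is_Pstar k N x al b1 b2 u w2 ->
  forall j, (j < N)%N -> forall y, cell x j y -> w1 y = w2 y.
Proof.
move=> k0 mx uT ui H b12 G0 Hw1 Hw2 j jN y yj; have [_ _ xlt] := mx.
have [q1 P1 ->//] := is_Pstar_cells mx uT ui H Hw1 jN.
have [q2 P2 ->//] := is_Pstar_cells mx uT ui H Hw2 jN.
apply: (cell_problem_unique k0 (xlt _ jN) H b12 (G0 _ jN) P1 P2).
by move: yj; rewrite /cell /= in_itv/= => /andP[? ?]; rewrite !ltW.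
Qed.

(** * Error estimates *)

(** One factor serves both norms: the sup norm needs 1, the L^2 norm needs the square root of the
    length. *)
Lemma Lp_norm_le (R : realType) (a b E : R) (f : R -> R) (p : \bar R) : a < b ->
  0 <= E -> measurable_fun `]a, b[ f ->
  {ae @lebesgue_measure R, forall x, `]a, b[%classic x -> `|f x| <= E} ->
  p = 2%:E \/ p = +oo%E ->
  (Lp_norm `]a, b[ p f <= (E * (1 + Num.sqrt (b - a)))%:E)%E.
Proof.
move=> ab E0 mf fE; have s0 : 0 <= Num.sqrt (b - a) by exact: sqrtr_ge0.
have ba0 : 0 <= b - a by rewrite subr_ge0 ltW.
case=> ->; rewrite /Lp_norm unlock /Lnorm; last first.
  rewrite lebesgue_measure_setT_gt0; apply/ess_supP.
  apply: ae_lebesgue_impl fE => x Hx; rewrite /= lee_fin patchE.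
  case: ifPn => [/set_mem xab|_]; last by rewrite normr0 mulr_ge0// addr_ge0.
  by rewrite (le_trans (Hx xab))// mulrDr mulr1 lerDl mulr_ge0.
have -> : (\int[@lebesgue_measure R]_x (`|(EFin \o f \_ `]a, b[) x| `^ 2) =
    \int[@lebesgue_measure R]_(x in `]a, b[) ((f x) ^+ 2)%:E)%E.
  rewrite [RHS]integral_mkcond; apply: eq_integral => x _.
  rewrite /= !patchE; case: ifPn => _.
    by rewrite powR_mulrn// real_normK// num_real.
  by rewrite normr0 powR0// pnatr_eq0.
have I : (\int[@lebesgue_measure R]_(x in `]a, b[) ((f x) ^+ 2)%:E <=
    (E ^+ 2 * (b - a))%:E)%E.
  apply: (@le_trans _ _ (\int[@lebesgue_measure R]_(x in `]a, b[) (E ^+ 2)%:E)%E).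
    apply: ae_ge0_le_integral => //.
    - by move=> x _; rewrite lee_fin sqr_ge0.
    - by apply/measurable_EFinP; exact: measurable_funX.
    - by move=> x _; rewrite lee_fin sqr_ge0.
    - apply: ae_lebesgue_impl fE => x Hx xab; rewrite lee_fin.
      rewrite -[leLHS]ger0_norm ?sqr_ge0// normrX.
      by apply: lerXn2r; rewrite ?nnegrE//; exact: Hx.
  by rewrite integral_cst//= lebesgue_measure_itv/= lte_fin ab.
have I0 : (0 <= \int[@lebesgue_measure R]_(x in `]a, b[) ((f x) ^+ 2)%:E)%E.
  by apply: integral_ge0 => x _; rewrite lee_fin sqr_ge0.
apply: (@le_trans _ _ ((E ^+ 2 * (b - a))%:E `^ 2^-1)%E).
  apply: gt0_ler_poweR => //; rewrite ?in_itv/= ?I0 ?leey//.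
  by rewrite lee_fin mulr_ge0// sqr_ge0.
rewrite poweR_EFin powR12_sqrt ?mulr_ge0 ?sqr_ge0// sqrtrM ?sqr_ge0//.
by rewrite sqrtr_sqr ger0_norm// lee_fin ler_wpM2l// lerDr.
Qed.

(** Cells are glued one at a time; adjoining a single mesh point preserves measurability whatever
    the value of f there. *)
Lemma mesh_measurable (R : realType) (a b : R) (N : nat) (x : nat -> R) (f : R -> R) :
  is_mesh a b N x ->
  (forall j, (j < N)%N -> exists2 g : R -> R, continuous g &
    forall y, cell x j y -> f y = g y) ->
  measurable_fun `]a, b[ f.
Proof.
move=> mx fg; have [x0 xN xlt] := mx; rewrite -x0 -xN.
have : (N <= N)%N by [].
elim: {-2}N => [_|j IH jN]; first by rewrite set_itv_ge ?bnd_simp ?ltxx//; exact: measurable_fun_set0.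
have x0j : x 0%N <= x j by exact: mesh_le mx (leq0n _) (ltnW jN).
have mj : measurable_fun `]x 0%N, x j] f.
  by apply/measurable_fun_itv_bndo_bndcP; exact: IH (ltnW jN).
have mc : measurable_fun `]x j, x j.+1[ f.
  have [g cg fgE] := fg j jN; apply: (eq_measurable_fun g).
    by move=> y /set_mem yj; rewrite fgE.
  by apply: measurable_funTS; exact: continuous_measurable_fun.
have -> : `]x 0%N, x j.+1[%classic = `]x 0%N, x j] `|` `]x j, x j.+1[%classic :> set R.
  by rewrite -itv_bndbnd_setU ?bnd_simp//; exact: xlt.
by apply/measurable_funU.
Qed.

Lemma mesh_ae (R : realType) (a b E : R) (N : nat) (x : nat -> R) (f : R -> R) :
  is_mesh a b N x ->
  (forall j, (j < N)%N -> forall y, cell x j y -> `|f y| <= E) ->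
  {ae @lebesgue_measure R, forall y, `]a, b[%classic y -> `|f y| <= E}.
Proof.
move=> mx fE; have [x0 xN xlt] := mx; rewrite -x0 -xN.
have : (N <= N)%N by [].
elim: {-2}N => [_|j IH jN].
  by apply: aeW => y /=; rewrite in_itv/= => /andP[/lt_trans h /h]; rewrite ltxx.
have nj : {ae @lebesgue_measure R, forall y, y != x j}.
  exists [set x j]; split; [exact: measurable_set1|exact: lebesgue_measure_set1|].
  by move=> y /= /negP; rewrite negbK => /eqP.
apply: filterS2 (IH (ltnW jN)) nj => [|y Hy yj].
  exact: (ae_filter_ringOfSetsType (@lebesgue_measure R)).
rewrite /= in_itv/= => /andP[y0 yj1].
have [ylt|ygt|/eqP] := ltgtP y (x j); last by rewrite (negbTE yj).
  by apply: Hy; rewrite /= in_itv/= y0.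
by apply: (fE _ jN); rewrite /cell /= in_itv/= ygt.
Qed.

Lemma cell_size_le (R : realType) (N : nat) (x : nat -> R) (j : nat) : (j < N)%N ->
  cell_size x j <= mesh_size N x.
Proof. by move=> jN; exact: (le_bigmax _ (fun i : 'I_N => cell_size x i) (Ordinal jN)). Qed.

Lemma min_cells_le (R : realType) (N : nat) (F : nat -> R) (j : nat) : (j < N)%N ->
  min_cells N F <= F j.
Proof. by move=> jN; exact: (bigmin_le _ (Ordinal jN) (fun i : 'I_N => F i)). Qed.

Lemma min_cells_gt0 (R : realType) (N : nat) (F : nat -> R) : (0 < N)%N ->
  (forall j, (j < N)%N -> 0 < F j) -> 0 < min_cells N F.
Proof.
move=> N0 F0; apply: (big_ind (fun m => 0 < m)) => [|p q p0 q0|j _].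
- exact: F0.
- by rewrite lt_min p0.
- exact: F0.
Qed.

Lemma regular_mesh_cell (R : realType) (a b sigma : R) (N : nat) (x : nat -> R)
    (j : nat) : a < b -> is_mesh a b N x -> regular_mesh sigma N x -> (j < N)%N ->
  mesh_size N x <= sigma * cell_size x j.
Proof.
move=> ab mx rx jN; have [_ _ xlt] := mx.
have m0 : 0 < min_cells N (cell_size x).
  by apply: min_cells_gt0 (mesh_gt0 ab mx) _ => i iN; rewrite subr_gt0 xlt.
have h0 : 0 <= mesh_size N x by exact: bigmax_ge_id.
move: (rx); rewrite /regular_mesh ltr_pdivrMr// => /ltW hs.
have s0 : 0 <= sigma.
  by apply: le_trans (ltW rx); rewrite divr_ge0// ltW.
by rewrite (le_trans hs)// ler_wpM2l// min_cells_le.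
Qed.

(** Passes from h to h_j: since 1 / h_j <= s / h, first-order quotients lose s and second-order ones
    s^2. Also s >= 1, so s^2 covers both. *)
Lemma scaled_parameters (R : realType) (c d b2 h hj s : R) (W : R) :
  0 < h -> 0 < hj -> hj <= h -> h <= s * hj ->
  Num.min (c / h) (d / h) <= W -> b2 / h ^+ 2 <= W ->
  0 <= c -> 0 <= d -> 0 <= b2 -> 0 <= W ->
  Num.min (c / hj) (d / hj) <= s ^+ 2 * W /\ b2 / hj ^+ 2 <= s ^+ 2 * W /\ 1 <= s ^+ 2.
Proof.
move=> h0 hj0 hjh hs cdW b2W c0 d0 b20 W0.
have s1 : 1 <= s.
  by rewrite -(ler_pM2r hj0) mul1r (le_trans hjh).
have s21 : 1 <= s ^+ 2 by rewrite exprn_ege1.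
have ih : hj^-1 <= s / h.
  by rewrite ler_pdivlMr// -ler_pdivlMl ?invr_gt0// invrK mulrC.
have ss : s <= s ^+ 2 by rewrite expr2 ler_peMl// (le_trans _ s1).
have sc (t : R) : 0 <= t -> t / hj <= s ^+ 2 * (t / h).
  move=> t0; apply: (@le_trans _ _ (s * (t / h))).
    by rewrite mulrCA ler_wpM2l.
  by rewrite ler_wpM2r// divr_ge0// ltW.
split; last split=> //.
  rewrite ge_min; move: cdW; rewrite ge_min => /orP[] H.
    by rewrite (le_trans (sc _ c0))// ler_wpM2l// (le_trans _ s21).
  by rewrite (le_trans (sc _ d0)) ?orbT// ler_wpM2l// (le_trans _ s21).
apply: (@le_trans _ _ (s ^+ 2 * (b2 / h ^+ 2))).
  rewrite mulrCA ler_wpM2l// -exprVn -expr_div_n.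
  have ihj0 : 0 <= hj^-1 by rewrite invr_ge0 ltW.
  by apply: lerXn2r => //; rewrite nnegrE// (le_trans ihj0).
by rewrite ler_wpM2l// (le_trans _ s21).
Qed.

Lemma Pstar_cell_error (R : realType) (a b sigma : R) (k : nat) : a < b -> (0 < k)%N ->
  exists2 C : R, 0 <= C & forall (N : nat) (x : nat -> R) (al b1 b2 M : R)
    (u w : R -> R), is_mesh a b N x -> regular_mesh sigma N x ->
  al ^+ 2 + b1 * b2 = 4^-1 -> b1 != 0 \/ b2 != 0 ->
  (forall j, (j < N)%N -> Gamma k x b1 b2 j != 0) ->
  periodic u (b - a) -> continuous u -> sobolev_infty [set: R] k.+1 u ->
  sobolev_infty_seminorm `]a, b[ k.+1 u = M%:E ->
  is_Pstar k N x al b1 b2 u w ->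
  let h := mesh_size N x in
  forall j, (j < N)%N -> forall y, cell x j y -> `|w y - u y| <=
    C * h ^+ k.+1 * M * (1 + Num.max `|b1| (Num.max
      (Num.min (`|2^-1 - al| / h) (`|2^-1 + al| / h)) (`|b2| / h ^+ 2))
      / min_cells N (fun j => `|Gamma k x b1 b2 j|)).
Proof.
move=> ab k0; have [C C0 HC] := cell_error R k0.
(* The first term bounds w - T, with sigma^2 from the rescaling of the parameters; the 1 bounds T -
   u. *)
exists (C * sigma ^+ 2 + 1); first by rewrite addr_ge0// mulr_ge0// sqr_ge0.
move=> N x al b1 b2 M u w mx rx H b12 G0 uT cu su uM Pw h j jN y yj.
have [x0 xN xlt] := mx.
have ui : (@lebesgue_measure R).-integrable `[a, b] (EFin \o u) by exact: integrable_contT.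
have [q Hq wq] := is_Pstar_cells mx uT ui H Pw jN.
have xab : a <= x j by rewrite -x0 (mesh_le mx)// ltnW.
have xba : x j.+1 <= b by rewrite -xN (mesh_le mx).
have [T sT HT] := sobolev_infty_taylor ab k0 cu su uM xab (xlt _ jN) xba.
set W := Num.max `|b1| _; set m := min_cells _ _.
set hj := x j.+1 - x j in HT.
have hj0 : 0 < hj by rewrite subr_gt0 xlt.
have hjh : hj <= h by exact: (cell_size_le x jN).
have h0 : 0 < h by exact: lt_le_trans hjh.
have hs : h <= sigma * hj by exact: (regular_mesh_cell ab mx rx jN).
have M0 : 0 <= M by rewrite -lee_fin -uM; exact: Lnorm_ge0.
have b1W : `|b1| <= W by rewrite le_max lexx.
have cdW : Num.min (`|2^-1 - al| / h) (`|2^-1 + al| / h) <= W.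
  by rewrite /W 2!le_max lexx /= orbT.
have b2W : `|b2| / h ^+ 2 <= W by rewrite /W 2!le_max lexx !orbT.
have W0 : 0 <= W by exact: le_trans b1W.
have [cdW' [b2W' s21]] := scaled_parameters h0 hj0 hjh hs cdW b2W
  (normr_ge0 _) (normr_ge0 _) (normr_ge0 _) W0.
have b1W' : `|b1| <= sigma ^+ 2 * W by rewrite (le_trans b1W)// ler_peMl.
pose Z := M * hj ^+ k.+1.
have Z0 : 0 <= Z by rewrite mulr_ge0// exprn_ge0// ltW.
have ZE : Z / hj = M * hj ^+ k.
  by rewrite /Z exprS; field; rewrite gt_eqF.
have xjl : x j <= x j <= x j.+1 by rewrite lexx ltW// xlt.
have xjr : x j <= x j.+1 <= x j.+1 by rewrite lexx ltW// xlt.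
have ylr : x j <= y <= x j.+1.
  by move: yj; rewrite /cell /= in_itv/= => /andP[? ?]; rewrite !ltW.
have m0 : 0 < m.
  by apply: min_cells_gt0 (mesh_gt0 ab mx) _ => i iN; rewrite normr_gt0 G0.
have mG : m <= `|Gamma k x b1 b2 j| by exact: (min_cells_le _ jN).
have key : `|q.[y] - T.[y]| <= C * Z * (1 + sigma ^+ 2 * W / `|Gamma k x b1 b2 j|).
  apply: (HC _ _ _ _ _ _ _ _ _ _ q T Z _ (xlt _ jN) H b12 (G0 _ jN)
    (mesh_integrable mx ui jN) Hq sT) => //.
  - by move=> z zj; have [] := HT z zj.
  - by have [] := HT _ xjl.
  - by rewrite -/hj ZE; have [] := HT _ xjl.
  - by have [] := HT _ xjr.
  - by rewrite -/hj ZE; have [] := HT _ xjr.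
(* Since sigma^2 >= 1, the factor can be pulled out of the whole sum. *)
have Wm : 1 + sigma ^+ 2 * W / `|Gamma k x b1 b2 j| <= sigma ^+ 2 * (1 + W / m).
  rewrite mulrDr mulr1 lerD// -mulrA ler_wpM2l ?sqr_ge0// ler_wpM2l//.
  by rewrite lef_pV2 ?posrE// normr_gt0 G0.
have Zh : Z <= h ^+ k.+1 * M.
  by rewrite /Z mulrC ler_wpM2r// lerXn2r// nnegrE ltW.
have Wm1 : 1 <= 1 + W / m by rewrite lerDl divr_ge0// ltW.
rewrite (wq y yj) -(subrKA T.[y]) (le_trans (ler_normD _ _))//.
have -> : (C * sigma ^+ 2 + 1) * h ^+ k.+1 * M * (1 + W / m) =
  C * (h ^+ k.+1 * M) * (sigma ^+ 2 * (1 + W / m)) + h ^+ k.+1 * M * (1 + W / m) by ring.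
apply: lerD.
  apply: (le_trans key); apply: ler_pM => //.
  - by rewrite mulr_ge0.
  - by rewrite addr_ge0// divr_ge0// mulr_ge0// sqr_ge0.
  - by rewrite ler_wpM2l.
have [uT' _] := HT _ ylr.
rewrite distrC (le_trans uT')// -/Z (le_trans Zh)// ler_peMr//.
by rewrite mulr_ge0// exprn_ge0// ltW.
Qed.

Theorem lemma3p2 (R : realType) (a b : R) (hab : a < b) (sigma : R)
    (k : nat) (hk : (1 <= k)%N) :
  (* existence and uniqueness *)
  (forall (N : nat) (x : nat -> R) (alpha1 beta1 beta2 : R),
     is_mesh a b N x -> regular_mesh sigma N x ->
     alpha1 ^+ 2 + beta1 * beta2 = 4^-1 ->
     beta1 != 0 \/ beta2 != 0 ->
     (forall j, (j < N)%N -> Gamma k x beta1 beta2 j != 0) ->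
     forall u : R -> R, Pstar_data a b N x u ->
       (exists w, is_Pstar k N x alpha1 beta1 beta2 u w) /\
       (forall w1 w2, is_Pstar k N x alpha1 beta1 beta2 u w1 ->
          is_Pstar k N x alpha1 beta1 beta2 u w2 ->
          forall j, (j < N)%N -> forall y, cell x j y -> w1 y = w2 y)) /\
  (* error estimates *)
  (exists C : R,
   forall (N : nat) (x : nat -> R) (alpha1 beta1 beta2 : R),
     is_mesh a b N x -> regular_mesh sigma N x ->
     alpha1 ^+ 2 + beta1 * beta2 = 4^-1 ->
     beta1 != 0 \/ beta2 != 0 ->
     (forall j, (j < N)%N -> Gamma k x beta1 beta2 j != 0) ->
     (* u denotes the continuous representative of its class *)
     forall u : R -> R, periodic u (b - a) -> continuous u ->
       sobolev_infty [set: R] k.+1 u ->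
     forall p : \bar R, p = 2%:E \/ p = +oo%E ->
       let h := mesh_size N x in
       (Lp_norm `]a, b[ p (fun y => Pstar k N x alpha1 beta1 beta2 u y - u y)%R
        <= (C * h ^+ k.+1)%R%:E * sobolev_infty_seminorm `]a, b[ k.+1 u *
           (1 + Num.max `|beta1|
                  (Num.max
                     (Num.min (`|2^-1 - alpha1| / h) (`|2^-1 + alpha1| / h))
                     (`|beta2| / h ^+ 2))
                / min_cells N (fun j => `|Gamma k x beta1 beta2 j|))%R%:E)%E).
Proof.
split=> [N x al b1 b2 mx _ H b12 G0 u [uT ui _]|].
  split=> [|w1 w2 Pw1 Pw2]; first exact: (Pstar_exists hk mx uT ui H b12 G0).
  exact: (Pstar_unique hk mx uT ui H b12 G0 Pw1 Pw2).
have [C C0 HC] := Pstar_cell_error sigma hab hk.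
have s0 : 0 <= Num.sqrt (b - a) by exact: sqrtr_ge0.
(* C may be 0; with C + 1 the constant is positive, so that the right-hand side is infinite whenever
   the seminorm is. *)
exists ((C + 1) * (1 + Num.sqrt (b - a))).
move=> N x al b1 b2 mx rx H b12 G0 u uT cu su p hp; cbv zeta; set h := mesh_size N x.
have [x0 xN xlt] := mx.
have ui : (@lebesgue_measure R).-integrable `[a, b] (EFin \o u) by exact: integrable_contT.
have Pw : is_Pstar k N x al b1 b2 u (Pstar k N x al b1 b2 u).
  by have := @xgetPex _ (cst 0 : R -> R) [set w | is_Pstar k N x al b1 b2 u w]
    (Pstar_exists hk mx uT ui H b12 G0).
set w := Pstar _ _ _ _ _ _ _ in Pw *.
set V := Num.max `|b1| _; set m := min_cells _ _.
have N0 : (0 < N)%N := mesh_gt0 hab mx.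
have h0 : 0 < h.
  by apply: lt_le_trans (cell_size_le x N0); rewrite subr_gt0 xlt.
have m0 : 0 < m by apply: min_cells_gt0 => // j jN; rewrite normr_gt0 G0.
have V0 : 0 <= V by rewrite le_max normr_ge0.
have Vm0 : 0 < 1 + V / m by rewrite ltr_pwDl// divr_ge0// ltW.
have C'0 : 0 < (C + 1) * (1 + Num.sqrt (b - a)) * h ^+ k.+1.
  by rewrite !mulr_gt0 ?exprn_gt0// ?ltr_wpDl// ltr_pwDl.
have : (0 <= sobolev_infty_seminorm `]a, b[ k.+1 u)%E by exact: Lnorm_ge0.
case uM : (sobolev_infty_seminorm _ _ _) => [M| |] // M0; last first.
  by rewrite gt0_muley ?lte_fin// gt0_mulye ?lte_fin// leey.
rewrite lee_fin in M0; rewrite -!EFinM.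
pose E := C * h ^+ k.+1 * M * (1 + V / m).
have E0 : 0 <= E by rewrite /E !mulr_ge0// ?exprn_ge0// ltW.
have wE := HC N x al b1 b2 M u w mx rx H b12 G0 uT cu su uM Pw.
have mf : measurable_fun `]a, b[ (fun y => w y - u y).
  apply: (mesh_measurable mx) => j jN.
  have [q _ wq] := is_Pstar_cells mx uT ui H Pw jN.
  exists (fun y => q.[y] - u y); last by move=> y /wq ->.
  by move=> y; apply: cvgB; [exact: continuous_horner|exact: cu].
apply: (le_trans (Lp_norm_le hab E0 mf (mesh_ae mx wE) hp)).
rewrite lee_fin /E.
have -> : (C + 1) * (1 + Num.sqrt (b - a)) * h ^+ k.+1 * M * (1 + V / m) =
  C * h ^+ k.+1 * M * (1 + V / m) * (1 + Num.sqrt (b - a)) +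
  h ^+ k.+1 * M * (1 + V / m) * (1 + Num.sqrt (b - a)) by ring.
by rewrite lerDl !mulr_ge0// ?exprn_ge0 ?addr_ge0// ?divr_ge0// ltW.
Qed.
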